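(* Let $K$ be a finite $k$-dimensional simplicial complex with $k\ge1$ and $K_k\neq\varnothing$, and let $D=d_1(K)$ be the maximum upper degree of a ridge. If $D=1$, then $\lambda_1(L^{\mathrm{up}}_{k-1}(K))=k+1=D+k$. Assume now that $D\ge2$. Then $$\lambda_1\bigl(L^{\mathrm{up}}_{k-1}(K)\bigr)=D+k$$ if and only if the following two conditions hold. (i) Every ridge of degree $D$ is clean. (ii) For every collection $\mathcal F\subseteq K_k$ with $\Gamma[\mathcal F]$ connected, $|\mathcal F|\ge D+2$ and $d_{\mathcal F}\ge D$, one has $$\sum_R (-1)^{m(R)+c(R)}\,2^{c(R)}\,\varepsilon(R)\,(D-1)^{i(R)}\ \ge\ 0,$$ where the sum ranges over all spanning elementary subgraphs $R$ of the signed graph $H_{\mathcal F}$.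
   Context: A simplicial complex $K$ on a finite vertex set is a collection of subsets closed under taking subsets; a face with $m+1$ vertices has dimension $m$, and $K_j$ is the set of $j$-dimensional faces; $K$ is $k$-dimensional if $k$ is the largest dimension of a face (purity is not assumed). The $k$-faces are called facets and the $(k-1)$-faces ridges. The (upper) degree of a ridge $\rho$ is $d(\rho)=|\{F\in K_k:\rho\subset F\}|$, and $d_1(K)=\max_\rho d(\rho)$. Choose an orientation (an ordering of the vertices, up to even permutations) of each face. The boundary matrix $B_k=([\sigma:F])_{\sigma\in K_{k-1},F\in K_k}$ has $[\sigma:F]=0$ if $\sigma\not\subset F$, and if $F=[v_0,\dots,v_k]$ and $\sigma=F\setminus\{v_i\}$ then $[\sigma:F]=(-1)^i\operatorname{sgn}(\pi)$, where $\pi$ is the permutation carrying $(v_0,\dots,\widehat{v_i},\dots,v_k)$ to the chosen ordering of $\sigma$. The up-Laplacian is $L^{\mathrm{up}}_{k-1}(K)=B_kB_k^{\mathsf T}$, and $\lambda_1$ denotes the largest eigenvalue. Two distinct facets $F,G$ are adjacent if they share a ridge $R=F\cap G$; then $\varepsilon(F,G)=[R:F][R:G]\in\{\pm1\}$. The signed facet-adjacency graph $\Sigma(K)$ has vertex set $K_k$, these adjacencies as edges, and $\varepsilon(F,G)$ as the sign of the edge $FG$; $\Gamma(K)$ is its underlying unsigned graph. For $\mathcal F\subseteq K_k$, $\Gamma[\mathcal F]$ is the induced unsigned graph, $H_{\mathcal F}$ the signed graph induced by $\Sigma(K)$ on $\mathcal F$, and $d_{\mathcal F}$ the maximum degree of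 $\Gamma[\mathcal F]$. The fan of a ridge $\rho$ of degree $D$ is $\mathcal F_\rho=\{F\in K_k:\rho\subset F\}$. Such a ridge is clean if every facet outside $\mathcal F_\rho$ is adjacent to either zero or two members of $\mathcal F_\rho$. A spanning elementary subgraph $R$ of $H_{\mathcal F}$ is a spanning subgraph each of whose connected components is an isolated vertex, an isolated edge (a single edge with its two endpoints), or a simple cycle of length at least three. $i(R)$, $m(R)$, $c(R)$ are the numbers of isolated-vertex, isolated-edge and cycle components. For a cycle $C$, $\varepsilon(C)$ is the product of the signs of its edges, and $\varepsilon(R)$ is the product of $\varepsilon(C)$ over the cycle components $C$ of $R$ (empty product $=1$). *)

(* Defs.v *)
From HB Require Import structures.
From mathcomp Require Import all_boot all_order all_algebra all_fingroup.
From mathcomp Require Import reals.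

Set Implicit Arguments.
Unset Strict Implicit.
Unset Printing Implicit Defensive.

Import Order.TTheory GRing.Theory Num.Theory.
Local Open Scope ring_scope.

Definition largest_eigenvalue (R : realType) (n : nat) (A : 'M[R]_n) (a : R) :=
  eigenvalue A a /\ (forall b : R, eigenvalue A b -> b <= a).

Section FiniteGraphs.
Variable T : finType.
Implicit Types (e : rel T) (A C : {set T}) (E : {set {set T}}).

Definition induced e A : rel T :=
  [rel x y | [&& x \in A, y \in A & e x y]].

Definition induced_connected e A :=
  {in A &, forall x y, connect (induced e A) x y}.

Definition induced_max_degree e A : nat :=
  (\max_(x in A) #|[set y in A | e x y]|)%N.

(* For an irreflexive e, every element is a two-element set of vertices. *)
Definition induced_edges e A : {set {set T}} :=
  [set [set x; y] | x in A, y in A & e x y].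

(* A spanning subgraph on the vertex set A is given by its edge set E alone;
   its connected components are represented by their vertex sets. *)
Definition components A E : {set {set T}} :=
  equivalence_partition (connect [rel x y | [set x; y] \in E]) A.

Definition edges_inside E C : {set {set T}} := [set a in E | a \subset C].

Definition is_isolated_vertex C := #|C| == 1%N.

Definition is_isolated_edge E C := C \in E.

Definition is_cycle E C :=
  (2 < #|C|)%N &&
  [exists s : #|C|.-tuple T,
    [&& uniq s, [set x in s] == C
      & edges_inside E C == [set [set x; next s x] | x in s]]].

Definition spanning_elementary e A E :=
  (E \subset induced_edges e A) &&
  [forall C in components A E,
    [|| is_isolated_vertex C, is_isolated_edge E C | is_cycle E C]].

Definition n_isolated_vertices A E : nat :=
  #|[set C in components A E | is_isolated_vertex C]|.

Definition n_isolated_edges A E : nat :=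
  #|[set C in components A E | is_isolated_edge E C]|.

Definition n_cycles A E : nat :=
  #|[set C in components A E | is_cycle E C]|.

Definition cycles_sign (sg : {set T} -> int) A E : int :=
  \prod_(C in components A E | is_cycle E C) \prod_(a in edges_inside E C) sg a.

End FiniteGraphs.

Section SimplicialComplexes.
Variable V : finType.
Implicit Types (K FF : {set {set V}}) (F G r : {set V}).
Implicit Types (o : {set V} -> seq V).

Definition simplicial_complex K :=
  forall F G, F \in K -> G \subset F -> G \in K.

Definition faces K (j : nat) : {set {set V}} := [set F in K | #|F| == j.+1].

Definition has_dimension K (k : nat) :=
  faces K k != set0 /\ (forall F, F \in K -> (#|F| <= k.+1)%N).

Definition fan K (k : nat) r : {set {set V}} :=
  [set F in faces K k | r \subset F].

Definition degree K (k : nat) r : nat := #|fan K k r|.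

Definition max_ridge_degree K (k : nat) : nat :=
  (\max_(r in faces K k.-1) degree K k r)%N.

(* An orientation is given by a representative ordering o F of each face F. *)
Definition orientation K o :=
  forall F, F \in K -> uniq (o F) /\ [set x in o F] = F.

(* The sign of the permutation carrying the sequence s to the sequence t. It is
   extended by the identity to a permutation of V, which preserves the sign. *)
Definition reordering_sign (s t : seq V) : int :=
  if [pick p : {perm V} | perm_on [set x in s] p && (map p s == t)] is Some p
  then (-1) ^+ p else 0.

(* The incidence number [r : F]. *)
Definition incidence o r F : int :=
  if [pick v in F | r == F :\ v] is Some v
  then (-1) ^+ index v (o F) * reordering_sign (rem v (o F)) (o r)
  else 0.

Definition boundary (R : realType) K o (k : nat) :
    'M[R]_(#|faces K k.-1|, #|faces K k|) :=
  \matrix_(i, j) (incidence o (enum_val i) (enum_val j))%:~R.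

(* For 0 < k, the up-Laplacian acting in dimension k - 1. *)
Definition up_laplacian (R : realType) K o (k : nat) :
    'M[R]_#|faces K k.-1| :=
  boundary R K o k *m (boundary R K o k)^T.

Definition facet_adj K (k : nat) : rel {set V} :=
  [rel F G | [&& F \in faces K k, G \in faces K k, F != G
                & F :&: G \in faces K k.-1]].

(* The sign is defined on unordered pairs {F, G}; see adj_signE. *)
Definition adj_sign o (a : {set {set V}}) : int :=
  \prod_(F in a) incidence o (\bigcap_(G in a) G) F.

Lemma adj_signE o F G : F != G ->
  adj_sign o [set F; G] =
  incidence o (F :&: G) F * incidence o (F :&: G) G.
Proof.
move=> neFG; have FG : F \notin [set G] by rewrite inE.
by rewrite /adj_sign !big_setU1 //= !big_set1.
Qed.

Definition clean K (k : nat) r :=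
  forall F, F \in faces K k -> F \notin fan K k r ->
    #|[set G in fan K k r | facet_adj K k F G]| = 0%N \/
    #|[set G in fan K k r | facet_adj K k F G]| = 2%N.

Definition elementary_sum K o (k D : nat) FF : int :=
  \sum_(E : {set {set {set V}}} | spanning_elementary (facet_adj K k) FF E)
    (-1) ^+ (n_isolated_edges FF E + n_cycles FF E)
    * 2 ^+ n_cycles FF E
    * cycles_sign (adj_sign o) FF E
    * (D%:Z - 1) ^+ n_isolated_vertices FF E.

End SimplicialComplexes.

(* Main.v *)
(* A = B_k^T B_k - (k + 1) I is the signed adjacency matrix of the facets, so the
   question is whether the largest eigenvalue of A is D - 1, in particular whether
   M = (D - 1) I - A is positive semidefinite.  The sum over spanning elementary
   subgraphs is the principal minor of M on the given collection of facets: group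
   the permutations of the Leibniz formula by the graph of their moved edges, two
   orientations per long cycle.

   If M is positive semidefinite its principal minors are nonnegative, and the
   vector [rho : F] on the fan of a ridge rho of degree D, on which the form of M
   vanishes, lies in the kernel of M; evaluated outside the fan this gives
   cleanness.  Conversely det (t I + M) is the sum of t^(n - |S|) det M[S], so
   nonnegative principal minors exclude negative eigenvalues of M.  The minors not
   covered by (ii) are handled directly: M[S] is block diagonal when S is
   disconnected, diagonally dominant when all degrees are at most D - 1, and when
   |S| = D + 1 with a vertex adjacent to all others, either S contains the fan of a
   ridge of degree D, whose vector is in the kernel by cleanness, or M[S] is
   positive semidefinite. *)
Require Import Defs.
From HB Require Import structures.
From mathcomp Require Import all_boot all_order all_algebra all_fingroup.
From mathcomp Require Import reals.
From mathcomp Require Import complex ring lra zify.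

Set Implicit Arguments.
Unset Strict Implicit.
Unset Printing Implicit Defensive.

Import Order.TTheory GRing.Theory Num.Theory.
Local Open Scope ring_scope.

(** * Permutations and their edges *)

Section PermutationEdges.
Variable T : finType.
Implicit Types (p q : {perm T}) (x y z : T) (C : {set T}) (E : {set {set T}}).

(** The undirected trace of [p]: a fixed point leaves no edge, an orbit of length two leaves a
    single edge, and a longer orbit leaves a cycle. *)
Definition perm_edges p : {set {set T}} :=
  [set [set x; p x] | x in [set x | p x != x]].

Lemma perm_edgesE p x y :
  ([set x; y] \in perm_edges p) = (x != y) && ((y == p x) || (x == p y)).
Proof.
apply/imsetP/andP => [[z]|[nxy /orP[/eqP Dy|/eqP Dx]]].
- rewrite inE => npz Exy; have nxy : x != y.
    apply: contraNneq npz => Dx; move: Exy; rewrite Dx setUid => /setP Ey.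
    have /set1P-> : p z \in [set y] by rewrite Ey set22.
    by have /set1P-> : z \in [set y] by rewrite Ey set21.
  split=> //; have := set21 x y; have := set22 x y; rewrite Exy !inE.
  by case/orP=> /eqP Dy /orP[]/eqP Dx; move: nxy; rewrite Dx Dy ?eqxx ?orbT.
- by exists x; rewrite ?inE -?Dy // eq_sym.
- by exists y; rewrite ?inE -?Dx // setUC.
Qed.

Lemma permV_edges p x y : (p x == y) = (x == (p^-1)%g y).
Proof. by rewrite -(inj_eq (@perm_inj _ p) x) permKV. Qed.

Lemma porbit_involutive p x : (p (p x) != x) = (2 < #|porbit p x|)%N.
Proof.
apply/idP/idP => [nppx|].
- have npx : p x != x by apply: contraNneq nppx => px; rewrite !px.
  have : [set x; p x; p (p x)] \subset porbit p x.
    {    apply/subsetP => y; rewrite !inE => /orP[/orP[]|] /eqP->.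
    + exact: porbit_id.
    + exact: (mem_porbit p 1 x).
    + by have := mem_porbit p 2 x; rewrite expgS expg1 permM. }
  move/subset_leq_card; apply: leq_trans.
  by rewrite -setUA cardsU1 cards2 !inE negb_or (inj_eq perm_inj) ![x == _]eq_sym npx nppx.
- apply: contraL => /eqP ppx; rewrite -leqNgt.
  suff /subset_leq_card/leq_trans-> : porbit p x \subset [set x; p x] => //.
    by rewrite cards2; case: (_ == _).
  apply/subsetP => _ /porbitP[i ->]; elim: i => [|i IH]; first by rewrite perm1 set21.
  by rewrite expgSr permM; case/set2P: IH => ->; rewrite ?set22 // ppx set21.
Qed.

Lemma porbit_stable p C x : (forall z, z \in C -> p z \in C) ->
  x \in C -> porbit p x \subset C.
Proof.
move=> stC xC; apply/subsetP => _ /porbitP[i ->].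
by elim: i => [|i IH]; rewrite ?perm1 // expgSr permM stC.
Qed.

(* Walking along a cycle, the successor is determined by the predecessor, so p
   either agrees with q on a whole orbit or reverses it. *)
Lemma perm_edges_agree p q x : perm_edges p = perm_edges q ->
  (p x = q x \/ p x = (q^-1)%g x) /\ (p x = q x -> p (q x) = q (q x)).
Proof.
move=> Epq.
have alt z : p z = q z \/ p z = (q^-1)%g z.
  have [pz|npz] := eqVneq (p z) z.
    left; apply/eqP; rewrite pz; apply: contraTT (eqxx z) => nqz.
    have : [set z; q z] \in perm_edges p.
      by rewrite Epq perm_edgesE nqz eqxx.
    rewrite perm_edgesE nqz pz eq_sym (negPf nqz) /= => /eqP zq.
    by move/eqP: nqz; case; apply: (@perm_inj _ p); rewrite -zq pz.
  have : [set z; p z] \in perm_edges q by rewrite -Epq perm_edgesE eq_sym npz eqxx.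
  rewrite perm_edgesE eq_sym npz => /orP[/eqP->|]; first by left.
  by rewrite eq_sym permV_edges => /eqP->; right.
(* The only possible disagreement at [q x] is that [p] turns back to [x]; the edge from [q x] to
   [q (q x)] then forces [q (q x) = x]. *)
split=> // pqx; have [//|pq] := alt (q x); move: pq; rewrite permK => pq.
have [qx|nqx] := eqVneq (q x) x; first by rewrite qx pqx.
have nqqx : q x != q (q x) by rewrite (inj_eq perm_inj) eq_sym.
have : [set q x; q (q x)] \in perm_edges p.
  by rewrite Epq perm_edgesE nqqx eqxx.
rewrite perm_edgesE nqqx => /orP[/eqP->//|].
by rewrite -{1}pqx (inj_eq perm_inj) pq => /eqP{1}->.
Qed.

Definition long_orbits p : {set {set T}} := [set C in porbits p | (2 < #|C|)%N].

Lemma mem_cover_porbits p (X : {set {set T}}) x : X \subset porbits p ->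
  (x \in cover X) = (porbit p x \in X).
Proof.
move=> /subsetP sX; apply/bigcupP/idP => [[C CX xC]|px]; last first.
  by exists (porbit p x) => //; apply: porbit_id.
have /imsetP[y _ Dy] := sX C CX.
by rewrite Dy -eq_porbit_mem in xC; rewrite (eqP xC) -Dy.
Qed.

Definition reverse_fun p (X : {set {set T}}) x :=
  if x \in cover X then (p^-1)%g x else p x.

(** The identity serves as default when [X] is not a set of orbits of [p], which makes [reverse]
    total. Otherwise [p] and its inverse preserve every orbit, so the two branches of [reverse_fun]
    have disjoint images. *)
Lemma reverse_subproof p (X : {set {set T}}) :
  injective (if X \subset porbits p then reverse_fun p X else id).
Proof.
case: ifPn => [sX x y|_ x y //]; rewrite /reverse_fun !(mem_cover_porbits _ sX).
have pp z : porbit p (p z) = porbit p z by apply: (porbit_perm p 1).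
have pV z : porbit p ((p^-1)%g z) = porbit p z by rewrite -pp permKV.
case: ifPn => Xx; case: ifPn => Xy.
- exact: perm_inj.
- by move/(congr1 (porbit p)); rewrite pp pV => Exy; rewrite -Exy Xx in Xy.
- by move/(congr1 (porbit p)); rewrite pp pV => Exy; rewrite Exy Xy in Xx.
- exact: perm_inj.
Qed.

Definition reverse p X : {perm T} := perm (@reverse_subproof p X).

Lemma reverseE p (X : {set {set T}}) x : X \subset porbits p ->
  reverse p X x = if porbit p x \in X then (p^-1)%g x else p x.
Proof. by move=> sX; rewrite permE /= sX /reverse_fun (mem_cover_porbits _ sX). Qed.

Lemma perm_edges_reverse p (X : {set {set T}}) : X \subset porbits p ->
  perm_edges (reverse p X) = perm_edges p.
Proof.
move=> sX; have pp z : porbit p (p z) = porbit p z by apply: (porbit_perm p 1).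
apply/eqP; rewrite eqEsubset; apply/andP; split; apply/subsetP => a /imsetP[x].
- rewrite inE => nx ->; rewrite perm_edgesE eq_sym nx /= reverseE //.
  by case: ifP => _; rewrite ?permKV eqxx ?orbT.
- rewrite inE => nx ->; rewrite perm_edgesE eq_sym nx /= !reverseE // pp.
  by case: ifP => _; rewrite ?permK eqxx ?orbT.
Qed.

(** On an orbit with more than two points the inverse differs from [p] everywhere, so [X] can be
    read off from where [reverse p X] disagrees with [p]. Shorter orbits are unchanged by
    reversal. *)
Lemma reverse_inj p : {in powerset (long_orbits p) &, injective (reverse p)}.
Proof.
have slp : long_orbits p \subset porbits p by apply/subsetP => C; rewrite inE => /andP[].
have memX (X : {set {set T}}) x : X \subset long_orbits p ->
    (porbit p x \in X) = (porbit p x \in long_orbits p) && (reverse p X x != p x).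
  move=> sX; rewrite reverseE ?(subset_trans sX) //.
  case: ifPn => [pX|]; last by rewrite eqxx andbF.
  have pL := subsetP sX _ pX; rewrite pL /= -(inj_eq (@perm_inj _ p)) permKV eq_sym.
  by move: pL; rewrite inE porbit_involutive => /andP[].
move=> X Y; rewrite !inE => sX sY Exy; apply/setP => C.
have [/imsetP[x _ ->]|nC] := boolP (C \in porbits p).
  by rewrite (memX X) // (memX Y) // Exy.
have nCX (Z : {set {set T}}) : Z \subset long_orbits p -> (C \in Z) = false.
  by move=> sZ; apply: contraNF nC => /(subsetP sZ)/(subsetP slp).
by rewrite !nCX.
Qed.

(** A permutation with the edges of [p] is obtained by reversing [p] along a set of long orbits, and
    this set is unique: two orientations for each long cycle. *)
Lemma card_perm_edges p :
  #|[set q | perm_edges q == perm_edges p]| = (2 ^ #|long_orbits p|)%N.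
Proof.
have slp : long_orbits p \subset porbits p by apply/subsetP => C; rewrite inE => /andP[].
rewrite -card_powerset -(card_in_imset (@reverse_inj p)); apply: eq_card => q.
rewrite inE; apply/eqP/imsetP => [Eqp|[X]]; last first.
  by rewrite inE => sX ->; rewrite perm_edges_reverse ?(subset_trans sX).
(* The agreement set is stable under [p], hence a union of orbits; outside it [q] is the inverse of
   [p] and the orbit is long. *)
pose A := [set x | q x == p x].
have stA z : z \in A -> p z \in A.
  rewrite !inE => /eqP qz; have [_ /(_ qz)] := perm_edges_agree z Eqp.
  by move=> ->.
have orbA x y : y \in porbit p x -> x \in A -> y \in A.
  by move=> yx xA; apply: (subsetP (porbit_stable stA xA)).
have altA x : x \notin A -> q x = (p^-1)%g x.
  by rewrite inE => /eqP; case: (perm_edges_agree x Eqp) => [[]].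
have longA x : x \notin A -> (2 < #|porbit p x|)%N.
  move=> xA; rewrite -porbit_involutive; apply: contraNneq (xA) => ppx.
  by rewrite inE altA // -{1}ppx permK.
pose X := [set C in long_orbits p | ~~ (C \subset A)].
have sX : X \subset long_orbits p by apply/subsetP => C; rewrite inE => /andP[].
exists X; first by rewrite inE.
apply/permP => x; rewrite reverseE ?(subset_trans sX) //.
have -> : (porbit p x \in X) = (x \notin A).
  rewrite inE; apply/andP/idP => [[_]|xA]; first by apply: contra => /(porbit_stable stA).
  split; first by rewrite inE longA // imset_f.
  by apply: contra xA => /subsetP; apply; apply: porbit_id.
by case: ifPn => [/altA//|]; rewrite negbK inE => /eqP.
Qed.

Lemma connect_perm_edges p x y :
  connect [rel x y | [set x; y] \in perm_edges p] x y = (y \in porbit p x).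
Proof.
set r := [rel x y | _].
have step z : connect r z (p z).
  have [->|npz] := eqVneq (p z) z; first exact: connect0.
  by apply: connect1; rewrite /= perm_edgesE eq_sym npz eqxx.
apply/idP/idP => [/connectP[s]|/porbitP[i ->]].
- elim: s x => [x _ ->|z s IH x /= /andP[xz /IH zs] /zs]; first exact: porbit_id.
  suff /eqP-> : porbit p x == porbit p z by [].
  move: xz; rewrite perm_edgesE => /andP[_ /orP[]/eqP->].
  + by rewrite (porbit_perm p 1).
  + by rewrite (porbit_perm p 1).
- elim: i => [|i IH]; first by rewrite perm1 connect0.
  by apply: connect_trans IH _; rewrite expgSr permM.
Qed.

Lemma components_perm p A : perm_on A p ->
  components A (perm_edges p) = [set porbit p x | x in A].
Proof.
move=> pA; apply: eq_in_imset => x xA; apply/setP => y.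
rewrite inE connect_perm_edges andb_idl // => /(subsetP (porbit_stable _ xA)); apply.
by move=> z; rewrite perm_closed.
Qed.

Lemma edges_inside_perm p x : edges_inside (perm_edges p) (porbit p x) =
  [set [set z; p z] | z in porbit p x & p z != z].
Proof.
apply/setP => a; rewrite inE; apply/andP/imsetP.
- case=> /imsetP[z]; rewrite inE => npz -> /subsetP sub.
  by exists z; rewrite // inE npz sub ?set21.
- case=> z; rewrite inE => /andP[zC npz] ->; split.
    by rewrite perm_edgesE eq_sym npz eqxx.
  by rewrite subUset !sub1set zC -eq_porbit_mem (porbit_perm p 1) eq_porbit_mem porbit_sym porbit_sym.
Qed.

Lemma isolated_edge_porbit p x :
  is_isolated_edge (perm_edges p) (porbit p x) = (#|porbit p x| == 2).
Proof.
apply/idP/idP => [/imsetP[z]|].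
  by rewrite inE eq_sym => npz ->; rewrite cards2 npz.
have -> : (#|porbit p x| == 2) = (p x != x) && (p (p x) == x).
{ have /= := uniq_traject_porbit p x; have := porbit_involutive p x.
  have := card_porbit_neq0 p x; have := iter_porbit p x.
  case: #|_| => [|[|[|n]]] //=.
  - by move=> ->; rewrite eqxx.
  - by rewrite inE andbT => -> _ _; rewrite eqxx eq_sym => ->.

  - by move=> _ _ /negPf->; rewrite andbF. }
case/andP=> npx /eqP ppx.
rewrite /is_isolated_edge; suff -> : porbit p x = [set x; p x].
  by rewrite perm_edgesE eq_sym npx eqxx.
apply/eqP; rewrite eqEsubset subUset !sub1set porbit_id (mem_porbit p 1).
rewrite porbit_stable ?set21 // => z /set2P[]->; first exact: set22.
by rewrite ppx set21.
Qed.

Lemma is_cycle_porbit p x :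
  is_cycle (perm_edges p) (porbit p x) = (2 < #|porbit p x|)%N.
Proof.
rewrite /is_cycle andb_idr // => gt2.
(* Listing the orbit by iterating [p] gives a cyclic order whose [next] is [p] itself. *)
pose s := traject p x #|porbit p x|.
have szs : size s == #|porbit p x| by rewrite size_traject.
have Us : uniq s by apply: uniq_traject_porbit.
have mems : [set y in s] = porbit p x by apply/setP => y; rewrite inE porbit_traject.
have cyc : fcycle p s.
  rewrite /s; have := iter_porbit p x; case: #|_| => //= n xn.
  by rewrite rcons_path fpath_traject /= last_traject; apply/eqP.
apply/existsP; exists (Tuple szs); rewrite /= Us mems eqxx /=.
apply/eqP; rewrite edges_inside_perm; apply/setP => a.
have nxt z : z \in porbit p x -> p z = next s z.
  by rewrite porbit_traject => /(next_cycle cyc)/eqP.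
have npz z : z \in porbit p x -> p z != z.
  move=> zx; have /eqP Ezx : porbit p z == porbit p x by rewrite eq_porbit_mem.
  move: gt2; rewrite -Ezx -porbit_involutive.
  by apply: contraNneq => pz; rewrite !pz.
apply/imsetP/imsetP => [[z]|[z zs ->]].
- by rewrite inE => /andP[zx _] ->; exists z; rewrite ?nxt // -porbit_traject.
- have zx : z \in porbit p x by rewrite porbit_traject.
  by exists z; rewrite ?nxt // inE zx npz.
Qed.

End PermutationEdges.

(** * Elementary subgraphs and the Leibniz formula *)

Section ElementarySubgraphs.
Variables (T : finType) (e : rel T).
Hypotheses (e_sym : symmetric e) (e_irr : irreflexive e).
Implicit Types (p q : {perm T}) (x y z : T) (A C : {set T}) (E : {set {set T}}).

(** These are the permutations supported on [A] whose moves all follow edges; the other Leibniz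
    terms of a principal minor contain a zero entry. *)
Definition graph_perm A p := perm_on A p && [forall x, (p x != x) ==> e x (p x)].

Lemma graph_edge_neq x y : e x y -> x != y.
Proof. by move=> exy; apply: contraTneq exy => ->; rewrite e_irr. Qed.

Lemma spanning_graph_perm A p :
  graph_perm A p -> spanning_elementary e A (perm_edges p).
Proof.
case/andP=> pA /forallP ep; apply/andP; split.
  apply/subsetP => _ /imsetP[x npx ->]; rewrite inE in npx.
  apply/imset2P; exists x (p x) => //; first exact: (subsetP pA).
  rewrite inE perm_closed //.
  by rewrite (subsetP pA) ?inE //= (implyP (ep x)).
apply/forall_inP => C; rewrite components_perm // => /imsetP[x _ ->].
rewrite isolated_edge_porbit is_cycle_porbit /is_isolated_vertex.
by have := card_porbit_neq0 p x; case: #|_| => [|[|[|]]].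
Qed.

Lemma spanning_edgeP A E a : spanning_elementary e A E -> a \in E ->
  exists x y, [/\ x \in A, y \in A, e x y & a = [set x; y]].
Proof.
case/andP=> /subsetP sE _ /sE /imset2P[x y xA]; rewrite inE => /andP[yA exy] ->.
by exists x, y.
Qed.

(** All three kinds of component are described by one cyclic sequence. The condition [next s x != x]
    discards the degenerate edge of a singleton, and a sequence of two vertices produces the same
    edge twice. *)
Lemma edges_inside_component A E C : spanning_elementary e A E ->
  C \in components A E ->
  exists s : seq T, [/\ uniq s, [set x in s] = C &
    edges_inside E C = [set [set x; next s x] | x in s & next s x != x]].
Proof.
move=> spE CE; have /andP[_ /forall_inP/(_ C CE)] := spE.
have edgeC a : a \in E -> #|a| = 2.
  case/(spanning_edgeP spE)=> x [y [_ _ /graph_edge_neq nxy ->]].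
  by rewrite cards2 nxy.
case/or3P=> [/cards1P[x Dx]|CinE|/andP[_ /existsP[s /and3P[Us /eqP Ds /eqP Es]]]].
- exists [:: x]; split=> //; first by rewrite Dx; apply/setP=> y; rewrite !inE.
  apply/setP => a; rewrite inE; apply/andP/imsetP => [[/edgeC a2 sa]|].
    by have := subset_leq_card sa; rewrite a2 Dx cards1.
  by case=> y; rewrite !inE /= => /andP[/eqP->]; rewrite eqxx eqxx.
- have [u [v [_ _ /graph_edge_neq nuv Duv]]] := spanning_edgeP spE CinE.
  exists [:: u; v]; split; first by rewrite /= inE nuv.
    by rewrite Duv; apply/setP=> y; rewrite !inE.
  have nu : next [:: u; v] u = v by rewrite /= eqxx.
  have nv : next [:: u; v] v = u by rewrite /= eq_sym (negPf nuv) eqxx.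
  apply/setP => a; rewrite inE; apply/andP/imsetP => [[aE sa]|].
    exists u; first by rewrite inE nu eq_sym nuv inE eqxx.
    apply/eqP; rewrite nu -Duv eqEcard sa.
    by rewrite (edgeC C) ?(edgeC a).
  case=> y; rewrite !inE => /andP[/orP[]/eqP->]; rewrite (nu, nv) => _ ->.
    by rewrite -Duv subxx.
  by rewrite setUC -Duv subxx.
- exists s; split=> //; rewrite Es.
  apply/setP => a; apply/imsetP/imsetP => [[x xs ->]|[x xs ->]]; exists x => //.
  + rewrite inE xs /=; have : [set x; next s x] \in edges_inside E C.
      by rewrite Es; apply/imsetP; exists x.
    rewrite inE => /andP[/edgeC + _]; rewrite cards2 eq_sym.
    by case: eqP.
  + by move: xs; rewrite inE => /andP[].
Qed.

Lemma connect_edges_sym E : connect_sym [rel x y | [set x; y] \in E].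
Proof. by apply: sym_connect_sym => x y; rewrite /= setUC. Qed.

Definition component A E x : {set T} :=
  [set y in A | connect [rel x y | [set x; y] \in E] x y].

Lemma mem_components A E x : x \in A -> component A E x \in components A E.
Proof. exact: imset_f. Qed.

Lemma component_id A E x : x \in A -> x \in component A E x.
Proof. by move=> xA; rewrite inE xA connect0. Qed.

Lemma eq_component A E x y : y \in component A E x -> component A E y = component A E x.
Proof.
rewrite inE => /andP[_ xy]; apply/setP => z.
by rewrite !inE (same_connect (@connect_edges_sym E) xy).
Qed.

(** The permutation sends each vertex to its successor in a cyclic enumeration of its component. *)
Lemma spanning_elementary_perm A E : spanning_elementary e A E ->
  exists2 p, graph_perm A p & perm_edges p = E.
Proof.
move=> spE.
(* The enumeration is chosen once per component, so that all its vertices follow the same cyclic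
   order. *)
have /fin_all_exists[s sP] (C : {set T}) : exists s : seq T, C \in components A E ->
    [/\ uniq s, [set x in s] = C &
    edges_inside E C = [set [set x; next s x] | x in s & next s x != x]].
  have [/(edges_inside_component spE)[s sP]|] := boolP (C \in components A E).
    by exists s.
  by exists [::].
pose cmp := component A E.
have Us x : x \in A -> uniq (s (cmp x)).
  by move=> xA; have [] := sP _ (mem_components E xA).
have mems x y : x \in A -> (y \in s (cmp x)) = (y \in cmp x).
  by move=> xA; have [_ /setP/(_ y)+ _] := sP _ (mem_components E xA); rewrite inE.
have Es x (xA : x \in A) := sP _ (mem_components E xA).
pose f x := if x \in A then next (s (cmp x)) x else x.
have fC x : x \in A -> f x \in cmp x.
  by move=> xA; rewrite /f xA -mems // mem_next mems // component_id.
have fA x : (f x \in A) = (x \in A).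
  by have [/fC|xA] := boolP (x \in A); rewrite ?inE ?/f ?(negPf xA) // => /andP[].
have f_inj : injective f.
  move=> x y Efxy; have Axy : (x \in A) = (y \in A) by rewrite -(fA x) Efxy fA.
  have [xA|xA] := boolP (x \in A); last first.
    by move: Efxy; rewrite /f -Axy (negPf xA).
  have yA : y \in A by rewrite -Axy.
  have Cxy : cmp x = cmp y.
    by rewrite /cmp -(eq_component (fC x xA)) Efxy (eq_component (fC y yA)).
  move: Efxy; rewrite /f xA yA Cxy.
  by apply: (can_inj (prev_next _)); apply: Us.
exists (perm f_inj).
  apply/andP; split.
    by apply/subsetP => x; rewrite inE permE /f; case: ifP; rewrite ?eqxx.
  apply/forallP => x; apply/implyP; rewrite permE => nfx.
  have xA : x \in A by move: nfx; rewrite /f; case: ifP; rewrite ?eqxx.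
  have : [set x; f x] \in edges_inside E (cmp x).
    have [_ _ ->] := Es x xA; apply/imsetP; exists x; last by rewrite /f xA.
    by rewrite inE mems // component_id //=; move: nfx; rewrite /f xA.
  rewrite inE => /andP[/(spanning_edgeP spE)[u [v [_ _ euv Exf]]] _].
  have := set21 x (f x); have := set22 x (f x); rewrite Exf.
  move=> /set2P[] Df /set2P[] Dx; rewrite Df Dx // in nfx *; rewrite ?eqxx // in nfx.
  by rewrite e_sym.
apply/setP => a; apply/imsetP/idP => [[x]|aE].
- rewrite inE permE => nfx ->.
  have xA : x \in A by move: nfx; rewrite /f; case: ifP; rewrite ?eqxx.
  have : [set x; f x] \in edges_inside E (cmp x).
    have [_ _ ->] := Es x xA; apply/imsetP; exists x; last by rewrite /f xA.
    by rewrite inE mems // component_id //=; move: nfx; rewrite /f xA.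
  by rewrite inE => /andP[].
- have [u [v [uA vA /graph_edge_neq nuv Da]]] := spanning_edgeP spE aE.
  have : a \in edges_inside E (cmp u).
    rewrite inE aE Da subUset !sub1set component_id //= inE vA /=.
    by apply: connect1; rewrite /= -Da.
  have [_ _ ->] := Es u uA => /imsetP[x]; rewrite inE mems // => /andP[xu nfx] ->.
  have xA : x \in A by move: xu; rewrite inE => /andP[].
  have Dcx : cmp x = cmp u by apply: eq_component.
  by exists x; rewrite ?inE permE /f xA Dcx.
Qed.

Lemma components_partition A E : partition (components A E) A.
Proof.
apply: equivalence_partitionP => x y z _ _ _; split; first exact: connect0.
by move/(same_connect (@connect_edges_sym E))->.
Qed.

(** The sign is the parity of the number of points minus the number of orbits; every point outside
    [A] is an orbit of its own and cancels. *)
Lemma sign_perm_on A p : perm_on A p ->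
  (-1) ^+ p = (-1) ^+ #|A| * (-1) ^+ #|components A (perm_edges p)| :> int.
Proof.
move=> pA; rewrite components_perm // /odd_perm.
have -> : porbits p = [set porbit p x | x in A] :|: [set porbit p x | x in ~: A].
  by rewrite -imsetU setUCr; apply/setP => C; apply/imsetP/imsetP => -[x _ ->]; exists x; rewrite ?inE.
rewrite cardsU (_ : _ :&: _ = set0) ?cards0 ?subn0.
  have -> : #|[set porbit p x | x in ~: A]| = #|~: A|.
    apply: card_in_imset => x y; rewrite !inE => xA yA /eqP; rewrite eq_porbit_mem.
    case/porbitP=> i ->; elim: i => [|i]; first by rewrite perm1.
    by rewrite expgSr permM => ->; rewrite (out_perm pA).
  by rewrite -(cardsC A) signr_addb !signr_odd !exprD mulrACA -expr2 sqrr_sign mulr1.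
apply/setP => C; rewrite !inE; apply/negP => /andP[/imsetP[x xA ->] /imsetP[y]].
rewrite inE => yA /eqP; rewrite eq_porbit_mem porbit_sym => yx.
have stA z : z \in A -> p z \in A by rewrite perm_closed.
by have /subsetP/(_ _ yx) := porbit_stable stA xA; rewrite (negPf yA).
Qed.

Variables (c : int) (sg : {set T} -> int).
Hypothesis sg_sq : forall x y, e x y -> sg [set x; y] * sg [set x; y] = 1.

(** The entries of [c] times the identity minus the signed adjacency matrix. *)
Definition signed_weight x y : int :=
  if x == y then c else if e x y then - sg [set x; y] else 0.

Lemma expr_card_cond (x : int) (P : {set {set T}}) (Q : pred {set T}) :
  x ^+ #|[set C in P | Q C]| = \prod_(C in P) (if Q C then x else 1).
Proof.
by rewrite -prodr_const big_mkcond [RHS]big_mkcond; apply: eq_bigr => C _; rewrite inE; case: (C \in P).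
Qed.

(** The sign of [p] is spread as one factor -1 per vertex of [A] and one per component. A fixed
    point then contributes [c], a 2-orbit contributes -1 since its edge sign is squared, and a long
    orbit contributes minus the product of its edge signs. *)
Lemma graph_perm_term A p (E := perm_edges p) : graph_perm A p ->
  (-1) ^+ p * \prod_(x in A) signed_weight x (p x) =
  (-1) ^+ (n_isolated_edges A E + n_cycles A E) * cycles_sign sg A E
    * c ^+ n_isolated_vertices A E.
Proof.
case/andP=> pA /forallP ep; rewrite (sign_perm_on pA) mulrAC -prodr_const -big_split /=.
rewrite (set_partition_big _ (components_partition A E)) /= -prodr_const -big_split /=.
rewrite /n_isolated_edges /n_cycles /n_isolated_vertices /cycles_sign exprD.
rewrite !expr_card_cond big_mkcondr /= -!big_split /=; apply: eq_bigr => C.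
rewrite components_perm // => /imsetP[x _ ->].
rewrite isolated_edge_porbit is_cycle_porbit /is_isolated_vertex.
have wE z : p z != z -> - 1 * signed_weight z (p z) = sg [set z; p z].
  by move=> npz; rewrite /signed_weight eq_sym (negPf npz) (implyP (ep z)) // mulN1r opprK.
have Cz z : z \in porbit p x -> porbit p z = porbit p x.
  by rewrite -eq_porbit_mem => /eqP.
have npC z : z \in porbit p x -> #|porbit p x| != 1%N -> p z != z.
  move=> zx; apply: contraNneq => pz; rewrite eqn_leq lt0n card_porbit_neq0 andbT.
  rewrite -(Cz z zx) -(cards1 z) subset_leq_card // porbit_stable ?set11 // => y.
  by move=> /set1P->; rewrite pz set11.
have [C1|C1] := eqVneq #|porbit p x| 1%N.
  have /cards1P[y Cy] : #|porbit p x| == 1%N by rewrite C1.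
  have := mem_porbit p 1 x; have := porbit_id p x; rewrite C1 Cy big_set1.
  move=> /set1P-> /set1P; rewrite expg1 => py.
  by rewrite /signed_weight py eqxx !mul1r mulrN1 mulN1r opprK.
have npx := npC x (porbit_id p x) C1.
rewrite mulr1 (eq_bigr (fun z => sg [set z; p z])); last first.
  by move=> z zx; rewrite wE ?npC.
have [C2|C2] := eqVneq #|porbit p x| 2%N.
  have ppx : p (p x) = x by apply/eqP; rewrite -[_ == _]negbK porbit_involutive C2.
  have -> : porbit p x = [set x; p x].
    apply/esym/eqP; rewrite eqEcard C2 cards2 eq_sym npx subUset !sub1set porbit_id.
    by rewrite (mem_porbit p 1).
  rewrite big_setU1 ?inE 1?eq_sym // big_set1 ppx cards2 eq_sym npx !mulr1.
  rewrite /= [[set p x; x]]setUC sg_sq ?mulrN1 //.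
  exact: (implyP (ep x)).
have C3 : (2 < #|porbit p x|)%N.
  by move: C1 C2 (card_porbit_neq0 p x); case: #|_| => [|[|[|]]].
rewrite C3 mul1r mulN1r mulrN1 edges_inside_perm; congr (- _).
rewrite (eq_bigl (fun z => z \in [set z in porbit p x | p z != z])); last first.
  by move=> z; rewrite [RHS]inE andb_idr // => zx; rewrite npC.
(* Distinct vertices of a long orbit give distinct edges: a coincidence would make [p] an involution
   there. *)
rewrite big_imset // => y z; rewrite !inE => /andP[yx _] /andP[zx _] Eyz.
have := set21 y (p y); have := set22 y (p y); rewrite Eyz.
move=> py /set2P[//|Dy]; move/set2P: py => [Dpy|/perm_inj//].
by move: C3; rewrite -(Cz z zx) -porbit_involutive -Dy Dpy eqxx.
Qed.

(** Terms with a move along a non-edge vanish. The others depend only on [perm_edges p], and each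
    elementary subgraph arises from 2 to the number of its cycles permutations. *)
Lemma sum_perm_elementary A :
  \sum_(p : {perm T} | perm_on A p) (-1) ^+ p * \prod_(x in A) signed_weight x (p x) =
  \sum_(E : {set {set T}} | spanning_elementary e A E)
    (-1) ^+ (n_isolated_edges A E + n_cycles A E) * 2 ^+ n_cycles A E
      * cycles_sign sg A E * c ^+ n_isolated_vertices A E.
Proof.
rewrite (bigID (fun p : {perm T} => [forall x, (p x != x) ==> e x (p x)])) /=.
rewrite [X in _ + X]big1 ?addr0 => [|p /andP[pA /forallPn[x]]]; last first.
  rewrite negb_imply => /andP[npx nex]; have xA : x \in A by apply: (subsetP pA); rewrite inE.
  by rewrite (bigD1 x) //= /signed_weight eq_sym (negPf npx) (negPf nex) mul0r mulr0.
rewrite (partition_big (@perm_edges T) (spanning_elementary e A)); last first.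
  by move=> p; apply: spanning_graph_perm.
apply: eq_bigr => E spE; have [p0 p0A Ep0] := spanning_elementary_perm spE.
(* Having edge set [E] already forces [p] to be supported on [A] and to move along edges of the
   graph. *)
have Efib p : graph_perm A p && (perm_edges p == E) = (perm_edges p == E).
  rewrite andb_idl // => /eqP Ep; apply/andP; split.
    apply/subsetP => x; rewrite inE => npx.
    have xE : [set x; p x] \in E by rewrite -Ep perm_edgesE eq_sym npx eqxx.
    have [u [v [uA vA _ Dx]]] := spanning_edgeP spE xE.
    by have := set21 x (p x); rewrite Dx => /set2P[]->.
  apply/forallP => x; apply/implyP => npx.
  have xE : [set x; p x] \in perm_edges p0 by rewrite Ep0 -Ep perm_edgesE eq_sym npx eqxx.
  move: xE; rewrite perm_edgesE; case/andP: p0A => _ /forallP ep.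
  case/andP=> nx /orP[]/eqP Dx; first by rewrite Dx (implyP (ep x)) // -Dx.
  by rewrite {1}Dx e_sym (implyP (ep (p x))) // -Dx.
rewrite (eq_bigl _ _ Efib).
rewrite (eq_bigr (fun=> (-1) ^+ (n_isolated_edges A E + n_cycles A E) * cycles_sign sg A E
    * c ^+ n_isolated_vertices A E)); last first.
  move=> p Ep; have := Ep; rewrite -Efib => /andP[pA /eqP{1}<-].
  by rewrite graph_perm_term // (eqP Ep).
rewrite sumr_const.
have -> : #|[pred p : {perm T} | perm_edges p == E]| = (2 ^ n_cycles A E)%N.
  rewrite -Ep0 -cardsE card_perm_edges; congr (2 ^ #|(_ : {set _})|)%N.
  have /andP[p0on _] := p0A.
  apply/setP => C; rewrite !inE components_perm //.
  apply/andP/andP => [[/imsetP[x _ ->] C3]|[/imsetP[x _ ->]]]; last first.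
    by rewrite is_cycle_porbit imset_f.
  rewrite is_cycle_porbit C3 imset_f //; apply: contraLR C3 => xA.
  by rewrite -porbit_involutive !(out_perm p0on) ?eqxx.
have -> : 2 ^+ n_cycles A E = (2 ^ n_cycles A E)%N%:R :> int by rewrite natrX.
by rewrite -[LHS]mulr_natr mulrAC (mulrAC _ (cycles_sign sg A E)).
Qed.

End ElementarySubgraphs.

(** * Principal minors *)

Section PermTransport.
Variable T : finType.

Lemma big_enum_val_all (S : Type) (idx : S) (op : Monoid.com_law idx) (F : T -> S) :
  \big[op/idx]_x F x = \big[op/idx]_(i < #|T|) F (enum_val i).
Proof. exact: (reindex _ (onW_bij _ (@enum_val_bij T))). Qed.

(** Conjugation by the enumeration of [T]; it translates the Leibniz formula over ordinals into a
    sum over permutations of [T]. *)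
Definition lift_to (s : 'S_#|T|) x := enum_val (s (enum_rank x)) : T.

Lemma lift_to_inj s : injective (lift_to s).
Proof. by move=> x y /enum_val_inj/perm_inj/enum_rank_inj. Qed.

Definition perm_of_ord s : {perm T} := perm (@lift_to_inj s).

Lemma perm_of_ordE s i : perm_of_ord s (enum_val i) = enum_val (s i).
Proof. by rewrite permE /lift_to enum_valK. Qed.

Lemma perm_of_ord_bij : bijective perm_of_ord.
Proof.
have f_inj (p : {perm T}) : injective (fun i : 'I_#|T| => enum_rank (p (enum_val i))).
  by move=> i j /enum_rank_inj/perm_inj/enum_val_inj.
exists (fun p : {perm T} => perm (f_inj p)) => [s|p]; apply/permP => x.
  by rewrite permE perm_of_ordE enum_valK.
by rewrite permE /lift_to permE enum_rankK enum_rankK.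
Qed.

(** The enumeration carries orbits to orbits, and the parity depends only on the numbers of points
    and orbits. *)
Lemma odd_perm_of_ord s : odd_perm (perm_of_ord s) = odd_perm s.
Proof.
rewrite /odd_perm card_ord; congr (_ (+) odd _).
have Eorb i : porbit (perm_of_ord s) (enum_val i) = enum_val @: porbit s i.
  have Epow j : (perm_of_ord s ^+ j)%g (enum_val i) = enum_val ((s ^+ j)%g i).
    elim: j => [|j IH]; first by rewrite !perm1.
    by rewrite !expgSr !permM IH perm_of_ordE.
  apply/setP => x; apply/porbitP/imsetP => [[j ->]|[y /porbitP[j ->] ->]].
    by exists ((s ^+ j)%g i); rewrite ?mem_porbit ?Epow.
  by exists j; rewrite Epow.
rewrite -(card_imset (porbits s) (imset_inj (@enum_val_inj _ T))); apply: eq_card => C.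
apply/imsetP/imsetP => [[x _ ->]|[_ /imsetP[i _ ->] ->]].
  by exists (porbit s (enum_rank x)); rewrite ?imset_f // -Eorb enum_rankK.
by exists (enum_val i).
Qed.

End PermTransport.

Section PrincipalMinors.
Variables (T : finType) (R : comNzRingType).
Implicit Types (f g M : T -> T -> R) (A B : {set T}).

Definition mx_of f : 'M[R]_#|T| := \matrix_(i, j) f (enum_val i) (enum_val j).

Lemma det_mx_of f :
  \det (mx_of f) = \sum_(p : {perm T}) (-1) ^+ p * \prod_x f x (p x).
Proof.
rewrite (reindex (@perm_of_ord T)) /=; last exact/onW_bij/perm_of_ord_bij.
apply: eq_bigr => s _; rewrite odd_perm_of_ord; congr (_ * _).
rewrite [RHS]big_enum_val_all.
by apply: eq_bigr => i _; rewrite mxE perm_of_ordE.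
Qed.

Lemma mul_mx_of f g :
  mx_of f *m mx_of g = mx_of (fun x y => \sum_z f x z * g z y).
Proof.
apply/matrixP => i j; rewrite !mxE.
rewrite [RHS]big_enum_val_all.
by apply: eq_bigr => k _; rewrite !mxE.
Qed.

(** The block of [M] on [A] is padded by the identity, so that all principal minors are determinants
    of one common size. *)
Definition minor_fun M A x y := if (x \in A) && (y \in A) then M x y else (x == y)%:R.

Definition pminor M A := \det (mx_of (minor_fun M A)).

Lemma pminorE M A :
  pminor M A = \sum_(p : {perm T} | perm_on A p) (-1) ^+ p * \prod_(x in A) M x (p x).
Proof.
rewrite /pminor det_mx_of [RHS]big_mkcond; apply: eq_bigr => p _.
case: ifPn => [pA|/subsetPn[x]]; last first.
  rewrite inE => npx xA; rewrite (bigD1 x) //= /minor_fun (negPf xA) /=.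
  by rewrite eq_sym (negPf npx) mul0r mulr0.
congr (_ * _); rewrite [RHS]big_mkcond; apply: eq_bigr => x _.
rewrite /minor_fun perm_closed // andbb; case: ifPn => // xA.
by rewrite (out_perm pA) // eqxx.
Qed.

(** Expanding every product of sums selects the set [B] of rows that take the term with [t]; the
    permutation must fix [B] pointwise, which leaves the minor on the complement. *)
Lemma det_shift M (t : R) :
  \det (mx_of (fun x y => t * (x == y)%:R + M x y)) =
  \sum_(B : {set T}) t ^+ #|B| * pminor M (~: B).
Proof.
rewrite det_mx_of; under eq_bigr => p _ do rewrite bigA_distr mulr_sumr.
rewrite exchange_big /=; apply: eq_bigr => B _; rewrite pminorE.
rewrite mulr_sumr [RHS]big_mkcond; apply: eq_bigr => p _.
case: ifPn => [pB|/subsetPn[x]].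
  rewrite mulrCA; congr (_ * _).
  rewrite (bigID (mem B)) /= -prodr_const; congr (_ * _).
    apply: eq_bigr => x xB; rewrite xB (out_perm pB) ?inE ?xB //.
    by rewrite eqxx mulr1.
  by apply: eq_big => x; rewrite ?inE // => /negPf->.
rewrite inE => npx; rewrite inE negbK => xB.
by rewrite (bigD1 x) //= xB eq_sym (negPf npx) mulr0 mul0r mulr0.
Qed.

(** With no entries between [A] and [B], the product of the two padded matrices is the padded matrix
    of the union. *)
Lemma pminor_disjoint M A B : [disjoint A & B] ->
  (forall x y, x \in A -> y \in B -> M x y = 0 /\ M y x = 0) ->
  pminor M (A :|: B) = pminor M A * pminor M B.
Proof.
move=> dAB M0; rewrite /pminor -det_mulmx mul_mx_of; congr (\det _).
apply/matrixP => i j; rewrite !mxE; move: (enum_val i) (enum_val j) => x y {i j}.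
have neqA z t : z \in A -> t \notin A -> (z == t) = false.
  by move=> zA; apply: contraNF => /eqP<-.
have [yA|yA] := boolP (y \in A).
  have NB z : minor_fun M B z y = (z == y)%:R.
    by rewrite /minor_fun (disjointFr dAB yA) andbF.
  rewrite (bigD1 y) //= big1 ?addr0 => [|z /negPf nzy]; last by rewrite NB nzy mulr0.
  rewrite NB eqxx mulr1 /minor_fun !inE yA orTb !andbT.
  have [//|xA] := boolP (x \in A); case: ifPn => // xB.
  by rewrite eq_sym (neqA y x) // (M0 y x yA xB).2.
have [xA|xA] := boolP (x \in A).
  rewrite big1 => [|z _].
    rewrite /minor_fun !inE xA (negPf yA) /= neqA //; case: ifPn => // yB.
    by rewrite (M0 x y xA yB).1.
  rewrite /minor_fun xA /=; have [zA|zA] := boolP (z \in A).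
    by rewrite (disjointFr dAB zA) /= (neqA z) // mulr0.
  by rewrite neqA ?mul0r.
have NA z : minor_fun M A x z = (x == z)%:R by rewrite /minor_fun (negPf xA).
rewrite (bigD1 x) //= big1 ?addr0 => [|z]; last first.
  by rewrite eq_sym NA => /negPf->; rewrite mul0r.
by rewrite NA eqxx mul1r /minor_fun !inE (negPf xA) (negPf yA).
Qed.

End PrincipalMinors.

(** * Determinants and quadratic forms over a real closed field *)

Section RealMinors.
Variables (T : finType) (R : rcfType).
Implicit Types (f g M : T -> T -> R) (A B : {set T}) (x y : T -> R).

Lemma det_mx_of_eq0P f :
  reflect (exists2 x, exists a, x a != 0 & forall b, \sum_a x a * f a b = 0)
    (\det (mx_of f) == 0).
Proof.
apply: (iffP (@det0P R _ _)) => [[v nv vf]|[x [a nxa] xf]].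
  exists (fun a => v 0 (enum_rank a)).
    have /rV0Pn[i nvi] := nv; exists (enum_val i); rewrite enum_valK //.
  move=> b; have /rowP/(_ (enum_rank b)) := vf; rewrite !mxE => vfb; rewrite -[RHS]vfb.
  by rewrite [LHS]big_enum_val_all; apply: eq_bigr => i _; rewrite !mxE enum_rankK enum_valK.
exists (\row_i x (enum_val i)).
  by apply/rV0Pn; exists (enum_rank a); rewrite mxE enum_rankK.
apply/rowP => j; rewrite !mxE -[RHS](xf (enum_val j)) [RHS]big_enum_val_all.
by apply: eq_bigr => i _; rewrite !mxE.
Qed.

Definition psd A M := forall x, 0 <= \sum_(a in A) \sum_(b in A) x a * M a b * x b.

Lemma sum_sqr_gt0 x a : x a != 0 -> 0 < \sum_b x b ^+ 2.
Proof.
move=> nxa; rewrite (bigD1 a) //= ltr_pwDl ?sumr_ge0 // => [|b _].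
  by rewrite lt_def sqrf_eq0 nxa sqr_ge0.
exact: sqr_ge0.
Qed.

Lemma sum_delta (a : T) (F : T -> R) : \sum_b F b * (b == a)%:R = F a.
Proof.
rewrite (bigD1 a) //= eqxx mulr1 big1 ?addr0 // => b /negPf->.
by rewrite mulr0.
Qed.

(** Deform the identity linearly into [f]. The determinant is a polynomial in [t], equal to 1 at 0;
    if it were negative at 1 it would vanish at some [t] in between, and a kernel vector there would
    make a positive multiple of its squared norm plus a nonnegative form value equal to 0. *)
Lemma det_psd_ge0 f : (forall x, 0 <= \sum_a \sum_b x a * f a b * x b) -> 0 <= \det (mx_of f).
Proof.
move=> f_psd; rewrite leNgt; apply/negP => det_lt0.
pose g (t : R) a b := (1 - t) * (a == b)%:R + t * f a b.
pose G : 'M[{poly R}]_#|T| := \matrix_(i, j)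
  ((1 - 'X) * ((enum_val i : T) == enum_val j)%:R + 'X * (f (enum_val i) (enum_val j))%:P).
have detG t : (\det G).[t] = \det (mx_of (g t)).
  rewrite -/(horner_eval t (\det G)) -det_map_mx; congr (\det _); apply/matrixP => i j.
  by rewrite /G !mxE rmorphD !rmorphM rmorphB rmorph1 rmorph_nat /= /horner_eval hornerX hornerC.
have g1 : mx_of (g 1) = mx_of f.
  by apply/matrixP => i j; rewrite !mxE /g subrr mul0r add0r mul1r.
have g0 : mx_of (g 0) = 1%:M.
  by apply/matrixP => i j; rewrite !mxE /g subr0 mul1r mul0r addr0 (inj_eq enum_val_inj).
have [||t /andP[t0 t1]] := @poly_ivt R (- \det G) 0 1; first exact: ler01.
  by rewrite !hornerN !detG g0 g1 det1 oppr_le0 ler01 oppr_ge0 ltW.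
rewrite /root hornerN detG oppr_eq0 => /det_mx_of_eq0P[x [a nxa] xg].
(* The root is not 1, where the determinant is negative; hence the weight [1 - t] of the identity is
   positive. *)
have {t1} t1 : t < 1.
  rewrite lt_neqAle t1 andbT; apply: contraTneq det_lt0 => Dt.
  rewrite -g1 -Dt -leNgt le_eqVlt eq_sym; apply/orP; left.
  by apply/det_mx_of_eq0P; exists x => //; exists a.
have : 0 < (1 - t) * (\sum_b x b ^+ 2) + t * (\sum_a \sum_b x a * f a b * x b).
  by rewrite ltr_pwDl ?mulr_gt0 ?mulr_ge0 ?subr_gt0 ?(sum_sqr_gt0 nxa).
suff -> : (1 - t) * (\sum_b x b ^+ 2) + t * (\sum_a \sum_b x a * f a b * x b)
    = \sum_b (\sum_a x a * g t a b) * x b.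
  by rewrite big1 ?ltxx // => b _; rewrite xg mul0r.
rewrite [X in t * X]exchange_big !mulr_sumr -big_split; apply: eq_bigr => b _ /=.
under [in RHS]eq_bigr do rewrite mulrDr !(mulrCA (x _)).
by rewrite big_split /= -!mulr_sumr sum_delta [RHS]mulrDl -!mulrA -expr2 mulr_suml.
Qed.

Lemma minor_fun_form M A x : \sum_a \sum_b x a * minor_fun M A a b * x b =
  \sum_(a in A) \sum_(b in A) x a * M a b * x b + \sum_(a in ~: A) x a ^+ 2.
Proof.
rewrite (bigID (mem A)) /=; congr (_ + _).
  apply: eq_bigr => a aA; rewrite [RHS]big_mkcond; apply: eq_bigr => b _.
  rewrite /minor_fun aA /=; case: ifPn => // bA; suff /negPf-> : a != b by rewrite mulr0 mul0r.
  by apply: contraNneq bA => <-.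
apply: eq_big => a; rewrite ?inE // => aA.
rewrite -[RHS](sum_delta a (fun b => x a * x b)); apply: eq_bigr => b _.
by rewrite /minor_fun (negPf aA) /= eq_sym mulrAC.
Qed.

Lemma pminor_psd_ge0 A M : psd A M -> 0 <= pminor M A.
Proof.
move=> MA; apply: det_psd_ge0 => x; rewrite minor_fun_form addr_ge0 ?MA //.
by apply: sumr_ge0 => a _; apply: sqr_ge0.
Qed.

Lemma pminor_eq0 A M x a : x a != 0 -> (forall b, b \notin A -> x b = 0) ->
  (forall b, b \in A -> \sum_a x a * M a b = 0) -> pminor M A = 0.
Proof.
move=> nxa x0 xM; apply/eqP/det_mx_of_eq0P; exists x; first by exists a.
move=> b; have [bA|bA] := boolP (b \in A).
  rewrite -[RHS](xM b bA); apply: eq_bigr => c _; rewrite /minor_fun bA andbT.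
  by case: ifPn => // cA; rewrite (x0 c cA) !mul0r.
rewrite -[RHS](x0 b bA) -[RHS](sum_delta b x); apply: eq_bigr => c _.
by rewrite /minor_fun (negPf bA) andbF.
Qed.

Lemma pminors_no_neg_eigen M t x : (forall A, 0 <= pminor M A) -> 0 < t ->
  (forall b, \sum_a x a * M a b = - t * x b) -> forall a, x a = 0.
Proof.
move=> Mge0 t0 xM a; apply/eqP; apply: contraT => nxa.
have : \det (mx_of (fun a b => t * (a == b)%:R + M a b)) == 0.
  apply/det_mx_of_eq0P; exists x; first by exists a.
  move=> b; under eq_bigr do rewrite mulrDr mulrCA.
  by rewrite big_split /= -mulr_sumr sum_delta xM mulNr subrr.
(* The full set contributes a positive power of [t] times the empty minor, which is 1; all other
   terms are nonnegative. *)
rewrite det_shift (bigD1 setT) //= setCT paddr_eq0.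
- case/andP=> + _; rewrite mulf_eq0 expf_eq0 (gt_eqF t0) andbF /=.
  rewrite pminorE (bigD1 1%g) ?perm_on1 //= big_set0 mulr1 odd_perm1 big1 ?addr0 ?oner_eq0 //.
  move=> p /andP[p0 /eqP[]]; apply/permP => z; rewrite perm1.
  by rewrite (out_perm p0) ?inE.
- by rewrite mulr_ge0 ?exprn_ge0 // ltW.
- by apply: sumr_ge0 => B _; rewrite mulr_ge0 ?exprn_ge0 // ltW.
Qed.

(** Each term is bounded by the mean of the two squares times the absolute entry; by symmetry both
    halves are sums over rows. *)
Lemma row_sum_form_le A M (d : R) x : (forall a b, M a b = M b a) ->
  (forall a, a \in A -> \sum_(b in A) `|M a b| <= d) ->
  \sum_(a in A) \sum_(b in A) x a * M a b * x b <= d * \sum_(a in A) x a ^+ 2.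
Proof.
move=> Msym Md.
have le2 a b : x a * M a b * x b <= `|M a b| * (x a ^+ 2 / 2) + `|M b a| * (x b ^+ 2 / 2).
  rewrite (Msym b a) -mulrDr -mulrDl mulrAC mulrC.
  apply: le_trans (ler_norm _) _; rewrite normrM ler_wpM2l // normrM.
  have := sqr_ge0 (`|x a| - `|x b|); rewrite sqrrB !real_normK ?num_real //.
  by lra.
apply: (@le_trans _ _ (\sum_(a in A) \sum_(b in A)
   (`|M a b| * (x a ^+ 2 / 2) + `|M b a| * (x b ^+ 2 / 2)))).
  by apply: ler_sum => a _; apply: ler_sum => b _.
under eq_bigr do rewrite big_split /=; rewrite big_split /=.
rewrite [X in _ + X]exchange_big -big_split mulr_sumr; apply: ler_sum => a aA /=.
rewrite -!mulr_suml -mulrDr -splitr; apply: ler_wpM2r; first exact: sqr_ge0.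
exact: Md.
Qed.

End RealMinors.

(** * Real symmetric matrices and the spectral theorem *)

Section Spectral.
Local Open Scope complex_scope.
Import ComplexField.
Variables (R : rcfType) (n : nat) (A : 'M[R]_n).
Let C := R[i].
Hypothesis A_sym : A^T = A.
Hypothesis A_eigen : forall b, eigenvalue A b -> 0 <= b.

(** Over the complex numbers [A] is unitarily diagonalisable. Its diagonal entries are real
    eigenvalues of [A], hence nonnegative, and the form is the sum of these entries times squared
    moduli. *)
Lemma sym_eigen_ge0_psd (v : 'rV[R]_n) : 0 <= (v *m A *m v^T) 0 0.
Proof.
pose toC : {rmorphism R -> C} := real_complex R.
pose B := map_mx toC A.
have wBw (w := map_mx toC v) : toC ((v *m A *m v^T) 0 0) = (w *m B *m w^T) 0 0.
  by rewrite /w /B map_trmx -!map_mxM [RHS]mxE.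
have Bherm : B \is hermsymmx.
  apply: realsym_hermsym; last first.
    by apply/mxOverP => i j; rewrite mxE; apply/complex_realP; exists (A i j).
  by apply/is_hermitianmxP; rewrite expr0 scale1r /B map_trmx A_sym map_mx_id.
have /orthomx_spectralP := hermitian_normalmx Bherm.
have Punit := spectral_unitarymx B; have d_real := hermitian_spectral_diag_real Bherm.
set P := spectralmx B in Punit *; set d := spectral_diag B in d_real * => DB.
have PV : P *m invmx P = 1%:M by rewrite mulmxV // unitarymx_unit.
have d_ge0 j : 0 <= d 0 j.
  have /complex_realP[r Dr] := mxOverP d_real 0 j.
  suff : eigenvalue B (d 0 j) by rewrite Dr (eigenvalue_map toC) => /A_eigen; rewrite lecR.
  apply/eigenvalueP; exists (row j P).
    by rewrite DB !mulmxA -!row_mul PV mul1mx mul_diag_mx; apply/rowP => i; rewrite !mxE.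
  apply/negP => /eqP Pj0; have /rowP/(_ j) : row j (P *m invmx P) = 0.
    by rewrite row_mul Pj0 mul0mx.
  by rewrite PV !mxE eqxx => /eqP; rewrite oner_eq0.
rewrite -lecR wBw; set w := map_mx toC v.
pose y := w *m invmx P.
(* Since [w] is real and [P] is unitary, the right factor of the form is the conjugate transpose of
   the left one. *)
have yE : P *m w^T = (map_mx Num.conj y)^T.
  rewrite /y invmx_unitary // map_mxM trmx_mul -map_mx_comp (map_mx_id (@conjCK _)) trmxK.
  by congr (_ *m _^T); apply/rowP => i; rewrite !mxE; apply/esym/CrealP/complex_realP; exists (v 0 i).
rewrite DB !mulmxA -/y -mulmxA yE mxE sumr_ge0 // => j _.
by rewrite mul_mx_diag !mxE mulrAC mulr_ge0 ?d_ge0 // mul_conjC_ge0.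
Qed.

End Spectral.

Lemma sym_form_ge0 (T : finType) (R : rcfType) (M : T -> T -> R) (x : T -> R) :
  (forall a b, M a b = M b a) ->
  (forall t (y : T -> R), t < 0 -> (forall b, \sum_a y a * M a b = t * y b) ->
     forall a, y a = 0) ->
  0 <= \sum_a \sum_b x a * M a b * x b.
Proof.
move=> Msym Mpos.
have Asym : (mx_of M)^T = mx_of M by apply/matrixP => i j; rewrite !mxE.
have := @sym_eigen_ge0_psd R _ _ Asym _ (\row_i x (enum_val i)).
have -> : \sum_a \sum_b x a * M a b * x b =
  ((\row_i x (enum_val i)) *m mx_of M *m (\row_i x (enum_val i))^T) 0 0.
  rewrite !mxE exchange_big [LHS]big_enum_val_all; apply: eq_bigr => i _.
  rewrite !mxE mulr_suml [LHS]big_enum_val_all; apply: eq_bigr => j _.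
  by rewrite !mxE.
apply=> t /eigenvalueP[v vM nv]; rewrite leNgt; apply: contra_neqN nv => t0.
have v0 a : v 0 (enum_rank a) = 0.
  apply: (Mpos t (fun a => v 0 (enum_rank a)) t0) => b.
  have /rowP/(_ (enum_rank b)) := vM; rewrite !mxE => <-.
  by rewrite [LHS]big_enum_val_all; apply: eq_bigr => i _; rewrite !mxE enum_rankK enum_valK.
by apply/rowP => i; rewrite mxE -(v0 (enum_val i)) enum_valK.
Qed.

(** * Orientations and adjacency signs *)

Section ReorderingSign.
Variable V : finType.
Implicit Types (s t u : seq V) (x y : V) (p q : {perm V}).

(** The permutation is determined on [s] by the two sequences and fixes everything else, so the
    choice made by [pick] is irrelevant. *)
Lemma reordering_signE s t p :
  perm_on [set x in s] p -> map p s = t -> reordering_sign s t = (-1) ^+ p.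
Proof.
move=> ps Dt; rewrite /reordering_sign; case: pickP => [q /andP[qs /eqP]|].
  rewrite -Dt => /eq_in_map Eqp; congr (_ ^+ odd_perm _); apply/permP => x.
  have [/Eqp//|xs] := boolP (x \in s).
  by rewrite (out_perm ps) ?(out_perm qs) ?inE.
by move/(_ p); rewrite ps Dt eqxx.
Qed.

Lemma reordering_exists s t : uniq s -> perm_eq s t ->
  exists2 p, perm_on [set x in s] p & map p s = t.
Proof.
move=> Us st; have Ut : uniq t by rewrite -(perm_uniq st).
have szst : size s = size t by apply: perm_size.
pose f x := if x \in s then nth x t (index x s) else x.
have fs x : (f x \in s) = (x \in s).
  rewrite /f; case: ifPn => [xs|/negPf//].
  by rewrite (perm_mem st) mem_nth // -szst index_mem.
have f_inj : injective f.
  move=> x y Efxy; have : (x \in s) = (y \in s) by rewrite -(fs x) Efxy fs.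
  move: Efxy; rewrite /f; case: ifP => xs; case: ifP => // ys + _.
  rewrite (set_nth_default x) -?szst ?index_mem // => /eqP.
  rewrite nth_uniq -?szst ?index_mem // => /eqP Exy.
  by rewrite -(nth_index x xs) -(nth_index x ys) Exy.
exists (perm f_inj).
  by apply/subsetP => x; rewrite !inE permE /f; case: ifP; rewrite ?eqxx.
case Et: t => [|x0 t']; first by apply: size0nil; rewrite size_map szst Et.
rewrite -Et; apply: (@eq_from_nth _ x0); rewrite size_map // => i lti.
rewrite (nth_map x0) // permE /f mem_nth // index_uniq //.
by apply: set_nth_default; rewrite -szst.
Qed.

Lemma reordering_sign_sqr s t : uniq s -> perm_eq s t ->
  reordering_sign s t * reordering_sign s t = 1.
Proof.
move=> Us /(reordering_exists Us)[p ps Dt].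
by rewrite (reordering_signE ps Dt) -expr2 sqrr_sign.
Qed.

Lemma reordering_sign_trans s t u : uniq s -> perm_eq s t -> perm_eq t u ->
  reordering_sign s u = reordering_sign s t * reordering_sign t u.
Proof.
move=> Us st tu; have Ut : uniq t by rewrite -(perm_uniq st).
have [p ps Dt] := reordering_exists Us st; have [q qt Du] := reordering_exists Ut tu.
rewrite (reordering_signE ps Dt) (reordering_signE qt Du) -signr_addb -odd_permM.
have Est : [set x in s] = [set x in t] by apply/setP => x; rewrite !inE (perm_mem st).
apply: reordering_signE; last by rewrite -Du -Dt -map_comp; apply: eq_map => x; rewrite permM.
by apply: perm_onM => //; rewrite Est.
Qed.

Lemma reordering_sign_refl s : reordering_sign s s = 1.
Proof.
rewrite (@reordering_signE s s 1%g) ?odd_perm1 ?perm_on1 //.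
by rewrite -[RHS]map_id; apply: eq_map => x; rewrite perm1.
Qed.

Lemma reordering_sign_sym s t : uniq s -> perm_eq s t ->
  reordering_sign s t = reordering_sign t s.
Proof.
move=> Us st; rewrite -[RHS]mul1r -(reordering_sign_sqr Us st) -mulrA.
by rewrite -reordering_sign_trans ?(perm_sym t) // reordering_sign_refl mulr1.
Qed.

Lemma reordering_sign_cons x s t : uniq (x :: s) -> perm_eq s t ->
  reordering_sign (x :: s) (x :: t) = reordering_sign s t.
Proof.
move=> /andP[xs Us] /(reordering_exists Us)[p ps Dt].
rewrite (reordering_signE ps Dt); apply: reordering_signE.
  by apply: subset_trans ps _; apply/subsetP => y; rewrite !inE => ->; rewrite orbT.
by rewrite /= Dt (out_perm ps) ?inE.
Qed.

(** Moving [x] to the front crosses the [index x s] entries before it, each by one transposition. *)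
Lemma reordering_sign_front x s : uniq s -> x \in s ->
  reordering_sign s (x :: rem x s) = (-1) ^+ index x s.
Proof.
elim: s => //= y s IH /andP[ys Us]; rewrite inE; have [->|nxy] /= := eqVneq x y.
  by rewrite reordering_sign_refl.
move=> xs.
have Hr : perm_eq (y :: s) [:: y, x & rem x s] by rewrite perm_cons perm_to_rem.
have Hs : perm_eq [:: y, x & rem x s] [:: x, y & rem x s].
  by rewrite (perm_catCA [:: y] [:: x]).
have Uys : uniq (y :: s) by rewrite /= ys.
rewrite (reordering_sign_trans Uys Hr Hs) reordering_sign_cons ?perm_to_rem //.
rewrite IH // exprS mulrC; congr (_ * _).
rewrite (@reordering_signE _ _ (tperm x y)) ?odd_tperm ?nxy //=.
  by apply/subsetP => z; rewrite !inE; case: tpermP => [->|->|]; rewrite ?eqxx ?orbT.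
rewrite tpermR tpermL; congr [:: _, _ & _]; rewrite -[RHS]map_id; apply/eq_in_map => z.
rewrite mem_rem_uniq // inE => /andP[/= nzx zs]; rewrite tpermD 1?eq_sym //.
by apply: contraNneq ys => <-.
Qed.

Lemma reordering_sign_rem x s t : uniq s -> perm_eq s t -> x \in s ->
  (-1) ^+ index x t * reordering_sign (rem x s) (rem x t) =
  (-1) ^+ index x s * reordering_sign s t.
Proof.
move=> Us st xs; have Ut : uniq t by rewrite -(perm_uniq st).
have xt : x \in t by rewrite -(perm_mem st).
have sr : perm_eq s (x :: rem x s) by apply: perm_to_rem.
have tr : perm_eq t (x :: rem x t) by apply: perm_to_rem.
have rr : perm_eq (x :: rem x s) (x :: rem x t).
  by rewrite -(permPl sr) -(permPr tr).
have Ur : uniq (x :: rem x s) by rewrite -(perm_uniq sr).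
have rt : perm_eq (x :: rem x s) t by rewrite -(permPl sr).
have tr' : perm_eq (x :: rem x t) t by rewrite perm_sym.
rewrite (reordering_sign_trans Us sr rt) (reordering_sign_trans Ur rr tr').
rewrite reordering_sign_front // reordering_sign_cons //; last by rewrite perm_cons in rr.
rewrite -(reordering_sign_sym Ut tr) reordering_sign_front //.
by rewrite signrMK mulrC.
Qed.

End ReorderingSign.

(** * Incidence numbers and signs of adjacent facets *)

Section Facets.
Variables (V : finType) (K : {set {set V}}) (o : {set V} -> seq V) (k : nat).
Hypotheses (hK : simplicial_complex K) (hk : (1 <= k)%N) (ho : orientation K o).
Implicit Types (F G H r S : {set V}) (x y v w : V).

Lemma enum_setD1 F v : enum (F :\ v) = rem v (enum F).
Proof.
rewrite rem_filter ?enum_uniq // /enum_mem -filter_predI; apply: eq_filter => x.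
by rewrite /= !inE.
Qed.

(** The enumeration order of [V] orients every vertex set, even outside [K]; this sign compares it
    with the chosen orientation. *)
Definition orientation_sign F : int := reordering_sign (enum F) (o F).

Lemma perm_enum_orientation F : F \in K -> perm_eq (enum F) (o F).
Proof.
move=> /ho[Uo Do]; apply: uniq_perm => // [|x]; first exact: enum_uniq.
by rewrite mem_enum -{1}Do inE.
Qed.

Lemma orientation_sign_sqr F : F \in K -> orientation_sign F * orientation_sign F = 1.
Proof. by move=> /perm_enum_orientation; apply: reordering_sign_sqr; apply: enum_uniq. Qed.

(** In the enumeration order the incidence number is the usual alternating sign; the chosen
    orientations only multiply it by the signs of the face and of the facet. *)
Lemma incidenceE F v : F \in K -> v \in F ->
  incidence o (F :\ v) F =
  (-1) ^+ index v (enum F) * (orientation_sign (F :\ v) * orientation_sign F).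
Proof.
move=> FK vF; have rK : F :\ v \in K by apply: hK FK _; apply: subD1set.
rewrite /incidence; case: pickP => [w /andP[wF /eqP Ew]|/(_ v)]; last by rewrite vF eqxx.
have -> : w = v.
  apply/eqP; apply: contraT => nwv; have : w \in F :\ v by rewrite !inE nwv.
  by rewrite Ew !inE eqxx.
have pF := perm_enum_orientation FK; have pr := perm_enum_orientation rK.
have vE : v \in enum F by rewrite mem_enum.
have UF := enum_uniq F.
have Erem := reordering_sign_rem UF pF vE; rewrite /orientation_sign mulrCA -Erem mulrCA.
congr (_ * _); rewrite enum_setD1 in pr *.
have prr : perm_eq (rem v (enum F)) (rem v (o F)).
  by rewrite -(perm_cons v) -(permPl (perm_to_rem vE)) (permPl pF) perm_to_rem // -(perm_mem pF).
have Ur : uniq (rem v (enum F)) by apply: rem_uniq.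
rewrite [RHS]mulrC (reordering_sign_sym Ur prr) -reordering_sign_trans //.
  by rewrite -(perm_uniq prr).
by rewrite perm_sym.
Qed.

Lemma incidence_sqr F v : F \in K -> v \in F ->
  incidence o (F :\ v) F * incidence o (F :\ v) F = 1.
Proof.
move=> FK vF; rewrite incidenceE // mulrACA -expr2 sqrr_sign mul1r mulrACA.
by rewrite !orientation_sign_sqr ?mul1r //; apply: hK FK _; apply: subD1set.
Qed.

(** Deleting the earlier of the two entries lowers the index of the later one by one, while deleting
    the later changes nothing. This is the sign behind the vanishing of the double boundary. *)
Lemma index_rem_sign (s : seq V) v w : uniq s ->
  v \in s -> w \in s -> v != w ->
  (-1) ^+ index v (rem w s) * (-1) ^+ index w (rem v s) =
  - ((-1) ^+ index v s * (-1) ^+ index w s) :> int.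
Proof.
elim: s => //= y s IH /andP[ys Us]; rewrite !inE.
have [->|nvy] := eqVneq v y; have [->|nwy] /= := eqVneq w y; rewrite ?eqxx //=.
- by move=> _ ws _; rewrite !mul1r exprS mulN1r opprK.
- by move=> vs _ _; rewrite !mulr1 exprS mulN1r opprK.
- move=> vs ws nvw; rewrite ![y == _]eq_sym (negPf nwy) (negPf nvy).
  by rewrite !exprS !mulN1r !mulrNN IH.
Qed.

Lemma facet_adjE F G : facet_adj K k F G =
  [&& F \in faces K k, G \in faces K k, F != G & #|F :&: G| == k].
Proof.
rewrite /facet_adj /=; have [FK|] := boolP (F \in faces K k) => //=.
congr [&& _, _ & _]; rewrite inE prednK // andb_idl // => _.
by move: FK; rewrite inE => /andP[FK _]; apply: hK FK _; apply: subsetIl.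
Qed.

Lemma facet_adj_sym : symmetric (facet_adj K k).
Proof.
by move=> F G; rewrite !facet_adjE andbCA eq_sym setIC.
Qed.

Lemma facet_adj_irr : irreflexive (facet_adj K k).
Proof. by move=> F; rewrite facet_adjE eqxx !andbF. Qed.

Lemma facet_adj_faces F G : facet_adj K k F G ->
  [/\ F \in faces K k, G \in faces K k, F != G & #|F :&: G| = k].
Proof. by rewrite facet_adjE => /and4P[-> -> -> /eqP]. Qed.

Lemma faces_card F : F \in faces K k -> #|F| = k.+1.
Proof. by rewrite inE => /andP[_ /eqP]. Qed.

Lemma faces_mem F : F \in faces K k -> F \in K.
Proof. by rewrite inE => /andP[]. Qed.

Lemma mem_ridges r : (r \in faces K k.-1) = (r \in K) && (#|r| == k).
Proof. by rewrite inE prednK. Qed.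

Lemma facet_adj_setD F G : facet_adj K k F G ->
  exists v, [/\ v \in F, F :\: G = [set v] & F :&: G = F :\ v].
Proof.
case/facet_adj_faces=> FK _ _ cFG.
have /cards1P[v Dv] : #|F :\: G| == 1%N.
  by rewrite -(eqn_add2l k) -{1}cFG cardsID (faces_card FK) addn1.
exists v; split=> //; first by have := set11 v; rewrite -Dv inE => /andP[].
by rewrite -Dv setDDr setDv set0U.
Qed.

Lemma fan_facet r F : r \in faces K k.-1 -> F \in fan K k r ->
  exists2 v, v \in F & r = F :\ v.
Proof.
rewrite mem_ridges inE => /andP[rK /eqP cr] /andP[FK rF].
have /cards1P[v Dv] : #|F :\: r| == 1%N by rewrite cardsDS // (faces_card FK) cr subSnn.
exists v; first by have := set11 v; rewrite -Dv inE => /andP[].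
by rewrite -Dv setDDr setDv set0U; apply/esym/setIidPr.
Qed.

Lemma incidence_fan_sqr r F : r \in faces K k.-1 -> F \in fan K k r ->
  incidence o r F * incidence o r F = 1.
Proof.
move=> rR rF; have [v vF ->] := fan_facet rR rF; apply: incidence_sqr => //.
by move: rF; rewrite inE => /andP[/faces_mem].
Qed.

Lemma fan_setI r F G : r \in faces K k.-1 -> F \in fan K k r -> G \in fan K k r ->
  F != G -> F :&: G = r.
Proof.
rewrite mem_ridges !inE => /andP[rK /eqP cr] /andP[/andP[FK /eqP cF] rF] /andP[/andP[GK /eqP cG] rG] nFG.
apply/esym/eqP; rewrite eqEcard subsetI rF rG cr -ltnS -cF; apply: proper_card.
rewrite properEneq subsetIl andbT; apply: contraNneq nFG => /setIidPl sFG.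
by rewrite eqEcard sFG cF cG leqnn.
Qed.

Lemma fan_adj r F G : r \in faces K k.-1 -> F \in fan K k r -> G \in fan K k r ->
  F != G -> facet_adj K k F G.
Proof.
move=> rR rF rG nFG; rewrite /facet_adj /= nFG (fan_setI rR) // rR.
by move: rF rG; rewrite !inE => /andP[-> _] /andP[-> _].
Qed.

Lemma fan_adj_sign r F G : r \in faces K k.-1 -> F \in fan K k r -> G \in fan K k r ->
  F != G -> adj_sign o [set F; G] = incidence o r F * incidence o r G.
Proof. by move=> rR rF rG nFG; rewrite adj_signE // (fan_setI rR). Qed.

Lemma adj_fan F G : facet_adj K k F G ->
  [/\ F :&: G \in faces K k.-1, F \in fan K k (F :&: G) & G \in fan K k (F :&: G)].
Proof. by case/and4P=> FK GK _ rR; split=> //; rewrite inE ?FK ?GK ?subsetIl ?subsetIr. Qed.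

Lemma adj_sign_sqr F G : facet_adj K k F G ->
  adj_sign o [set F; G] * adj_sign o [set F; G] = 1.
Proof.
move=> FG; have [rR rF rG] := adj_fan FG; have [_ _ nFG _] := facet_adj_faces FG.
rewrite (fan_adj_sign rR rF rG nFG) mulrACA.
by rewrite !(incidence_fan_sqr rR) ?mulr1.
Qed.

(** All three signs are products of incidences with the same ridge, and that of [F] is squared. *)
Lemma adj_same_ridge F G H : facet_adj K k F G -> facet_adj K k F H -> G != H ->
  F :&: G = F :&: H -> facet_adj K k G H /\
  adj_sign o [set G; H] = adj_sign o [set F; G] * adj_sign o [set F; H].
Proof.
move=> FG FH nGH Er; have [rR rF rG] := adj_fan FG; have [_ _ rH] := adj_fan FH.
rewrite -Er in rH; have [_ _ nFG _] := facet_adj_faces FG.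
have [_ _ nFH _] := facet_adj_faces FH.
split; first exact: fan_adj rG rH nGH.
rewrite (fan_adj_sign rR rG rH) // (fan_adj_sign rR rF rG) // (fan_adj_sign rR rF rH) //.
by rewrite mulrACA incidence_fan_sqr // mul1r.
Qed.

(* Two faces S - v and S - w of a common simplex S (which need not belong to K)
   induce opposite orientations on S - v - w. *)
Definition simplex_sign S v : int :=
  orientation_sign (S :\ v) * (-1) ^+ index v (enum S).

Lemma adj_sign_simplex S v w : v \in S -> w \in S -> v != w ->
  S :\ v \in K -> S :\ w \in K ->
  adj_sign o [set S :\ v; S :\ w] = - (simplex_sign S v * simplex_sign S w).
Proof.
move=> vS wS nvw SvK SwK.
have Er : (S :\ v) :&: (S :\ w) = (S :\ v) :\ w.
  by apply/setP => x; rewrite !inE; case: (x == w); rewrite ?andbF //=; case: (x \in S); rewrite ?andbF ?andbT.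
have Er' : (S :\ v) :&: (S :\ w) = (S :\ w) :\ v.
  by rewrite Er; apply/setP => x; rewrite !inE andbCA.
have nS : S :\ v != S :\ w.
  apply: contraNneq nvw => /setP/(_ v); rewrite !inE vS eqxx /= => /esym/negbT.
  by rewrite andbT negbK.
(* The common ridge is written as a vertex deletion from each of the two faces; its orientation sign
   occurs squared, and [index_rem_sign] gives the minus sign. *)
rewrite adj_signE // {1}Er Er' incidenceE ?inE 1?eq_sym ?nvw //.
rewrite incidenceE ?inE ?nvw // -Er' -Er !enum_setD1.
have irs := index_rem_sign (enum_uniq S) _ _ nvw; rewrite !mem_enum in irs.
have rK := @orientation_sign_sqr ((S :\ v) :&: (S :\ w)) (hK SvK (subsetIl _ _)).
rewrite mulrACA [X in X * _]mulrC irs // mulNr; congr (- _).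
by rewrite [X in _ * X]mulrACA rK mul1r mulrC mulrACA.
Qed.

(** The three facets are codimension-one faces of the simplex [S] on [F] and the common new vertex
    [b]. Each adjacency sign is then minus a product of two simplex signs, and that of [F] is
    squared. *)
Lemma adj_same_vertex F G H : facet_adj K k F G -> facet_adj K k F H -> G != H ->
  G :\: F = H :\: F -> facet_adj K k G H /\
  adj_sign o [set G; H] = - (adj_sign o [set F; G] * adj_sign o [set F; H]).
Proof.
move=> FG FH nGH Ev.
have [v [vF _ FGv]] := facet_adj_setD FG; have [w [wF _ FHw]] := facet_adj_setD FH.
have [|b [bG Gb _]] := @facet_adj_setD G F; first by rewrite facet_adj_sym.
have [FK GK nFG _] := facet_adj_faces FG; have [_ HK nFH _] := facet_adj_faces FH.
have bF : b \notin F by have := set11 b; rewrite -Gb inE => /andP[].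
pose S := b |: F.
have DF : F = S :\ b by rewrite setU1K.
have nb x : x \in F -> b != x by move=> xF; apply: contraNneq bF => ->.
have coface X x : x \in F -> X :\: F = [set b] -> F :&: X = F :\ x -> X = S :\ x.
  move=> xF Xb FX; rewrite -(setID X F) setIC FX Xb; apply/setP => y; rewrite !inE.
  by case: (y =P b) => [->|_]; rewrite ?orbF // orbT (nb x xF).
have DG : G = S :\ v by apply: coface.
have DH : H = S :\ w by apply: coface; rewrite // -Ev.
have xS x : x \in F -> x \in S by move=> xF; rewrite inE xF orbT.
have bS : b \in S by rewrite setU11.
have nvw : v != w by apply: contraNneq nGH => Evw; rewrite DG DH Evw.
have cS : #|S| = k.+2 by rewrite cardsU1 bF (faces_card FK).
split.
  rewrite facet_adjE GK HK nGH /= DG DH.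
  have -> : (S :\ v) :&: (S :\ w) = (S :\ v) :\ w.
    apply/setP => x; rewrite !inE.
    by case: (x \in F); case: (x == b); case: (x == v); case: (x == w).
  have wSv : w \in S :\ v by rewrite in_setD1 eq_sym nvw xS.
  have := cardsD1 v S; rewrite (cardsD1 w (S :\ v)) wSv xS // cS !add1n => -[<-].
  exact: eqxx.
have [vS wS] := (xS v vF, xS w wF).
have bK : S :\ b \in K by rewrite -DF faces_mem.
have vK : S :\ v \in K by rewrite -DG faces_mem.
have wK : S :\ w \in K by rewrite -DH faces_mem.
have -> : adj_sign o [set F; G] = - (simplex_sign S b * simplex_sign S v).
  by rewrite DG {1}DF adj_sign_simplex ?nb.
have -> : adj_sign o [set F; H] = - (simplex_sign S b * simplex_sign S w).
  by rewrite DH {1}DF adj_sign_simplex ?nb.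
rewrite DG DH adj_sign_simplex //; congr (- _).
have sqb : simplex_sign S b * simplex_sign S b = 1.
  rewrite /simplex_sign mulrACA -DF orientation_sign_sqr ?faces_mem // mul1r.
  by rewrite -expr2 sqrr_sign.
by rewrite mulrNN [RHS]mulrACA sqb mul1r.
Qed.

(** If the new vertices of [G] and [H] differ, then [G :&: H] lies in [F], hence in both ridges of
    [F]; distinct ridges meet in fewer than [k] vertices. *)
Lemma adj_cases F G H : facet_adj K k F G -> facet_adj K k F H -> facet_adj K k G H ->
  F :&: G = F :&: H \/ G :\: F = H :\: F.
Proof.
move=> FG FH GH; have [->|nr] := eqVneq (F :&: G) (F :&: H); [by left|right].
have [|v [_ Gv _]] := @facet_adj_setD G F; first by rewrite facet_adj_sym.
have [|w [_ Hw _]] := @facet_adj_setD H F; first by rewrite facet_adj_sym.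
rewrite Gv Hw; have [->//|nvw] := eqVneq v w.
have [_ _ _ cGH] := facet_adj_faces GH; have [_ _ _ cFG] := facet_adj_faces FG.
have [_ _ _ cFH] := facet_adj_faces FH.
have sGH : G :&: H \subset (F :&: G) :&: (F :&: H).
  apply/subsetP => x; rewrite !inE => /andP[xG xH]; rewrite xG xH !andbT andbb.
  apply: contraT => xF; move: nvw.
  have /set1P <- : x \in [set v] by rewrite -Gv inE xF.
  have /set1P <- : x \in [set w] by rewrite -Hw inE xF.
  by rewrite eqxx.
have : (#|(F :&: G) :&: (F :&: H)| < k)%N.
  rewrite -[X in (_ < X)%N]cFG; apply: proper_card; rewrite properEneq subsetIl andbT.
  apply: contraNneq nr => /setIidPl sFG.
  by rewrite eqEcard sFG cFG cFH leqnn.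
by rewrite ltnNge -{1}cGH subset_leq_card.
Qed.

Lemma adj_ridge_vertex F G H : F :&: G = F :&: H -> G :\: F = H :\: F -> G = H.
Proof. by move=> Er Ev; rewrite -(setID G F) -(setID H F) Ev setIC Er setIC. Qed.

End Facets.

(** * The shifted adjacency matrix of the facets *)

Section Forms.
Variables (T U : finType) (R : rcfType).
Implicit Types (M : T -> T -> R) (A : {set T}) (x : T -> R).

(** Perturbing [x] along the coordinate [b] gives a nonnegative quadratic in [t] without constant
    term, so its linear coefficient must vanish. *)
Lemma psd_kernel M x : (forall a b, M a b = M b a) -> psd setT M ->
  \sum_b (\sum_a x a * M a b) * x b = 0 -> forall b, \sum_a x a * M a b = 0.
Proof.
move=> Msym Mpsd x0 b; set c := \sum_a _.
have form y : \sum_(a in setT) \sum_(b in setT) y a * M a b * y b = \sum_b (\sum_a y a * M a b) * y b.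
  rewrite exchange_big /=; apply: eq_big => [?|d _]; first by rewrite inE.
  by rewrite mulr_suml; apply: eq_bigl => ?; rewrite inE.
have delta_sum d : \sum_a (a == b)%:R * M a d = M b d.
  by rewrite -[RHS](sum_delta b (fun a => M a d)); apply: eq_bigr => a _; rewrite mulrC.
have m0 : 0 <= M b b.
  by have := Mpsd (fun a => (a == b)%:R); rewrite form sum_delta delta_sum.
have key t : 0 <= t * c *+ 2 + t ^+ 2 * M b b.
  have := Mpsd (fun a => x a + t * (a == b)%:R); rewrite form.
  have E d : \sum_a (x a + t * (a == b)%:R) * M a d = \sum_a x a * M a d + t * M b d.
    under eq_bigr do rewrite mulrDl -mulrA.
    by rewrite big_split /= -mulr_sumr delta_sum.
  under eq_bigr do rewrite E mulrDl !mulrDr.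
  rewrite !big_split /= x0 add0r.
  have -> : \sum_i (\sum_a x a * M a i) * (t * (i == b)%:R) = t * c.
    by under eq_bigr do rewrite mulrA; rewrite sum_delta mulrC.
  have -> : \sum_i t * M b i * (t * (i == b)%:R) = t ^+ 2 * M b b.
    under eq_bigr do rewrite mulrA; rewrite sum_delta.
    by ring.
  have -> : \sum_i t * M b i * x i = t * c.
    rewrite mulr_sumr; apply: eq_bigr => a _; rewrite (Msym b).
    by ring.
  by rewrite mulr2n addrA.
apply/eqP; apply: contraT => nc.
have c2 : 0 < c ^+ 2 by rewrite lt_def sqrf_eq0 nc sqr_ge0.
have m1 : 0 < M b b + 1 by lra.
(* Nearly the minimiser of the quadratic; the added 1 keeps the denominator positive when the
   diagonal entry is zero. *)
have := key (- c / (M b b + 1)).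
have -> : - c / (M b b + 1) * c *+ 2 + (- c / (M b b + 1)) ^+ 2 * M b b =
  - (c ^+ 2 / (M b b + 1) ^+ 2 * (M b b + 2)).
  by field; rewrite gt_eqF.
have m2 : 0 < M b b + 2 by lra.
by rewrite oppr_ge0 leNgt mulr_gt0 // divr_gt0 // exprn_gt0.
Qed.

(** The form is the sum of squares of the fibre sums [t j]. Each square is at least
    [y * t j - y ^+ 2 / 4], and there are at most [#|A|] fibres. *)
Lemma fiber_form_ge A (f : T -> U) x y :
  y * \sum_(a in A) x a - #|A|%:R * (y ^+ 2 / 4) <=
  \sum_(a in A) \sum_(b in A) x a * (f a == f b)%:R * x b.
Proof.
pose t j := \sum_(a in A | f a == j) x a.
have -> : \sum_(a in A) \sum_(b in A) x a * (f a == f b)%:R * x b =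
    \sum_(j in f @: A) t j ^+ 2.
  rewrite (partition_big_imset f); apply: eq_bigr => j _.
  rewrite expr2 [X in X * _]/t mulr_suml; apply: eq_bigr => a /andP[_ /eqP fa].
  rewrite /t mulr_sumr [RHS]big_mkcondr /=; apply: eq_bigr => b _; rewrite fa eq_sym.
  by case: eqP => _; rewrite ?mulr1 ?mulr0 ?mul0r.
rewrite (partition_big_imset f) /=.
have cA : #|f @: A|%:R <= #|A|%:R :> R by rewrite ler_nat leq_imset_card.
apply: (@le_trans _ _ (\sum_(j in f @: A) (y * t j - y ^+ 2 / 4))).
  rewrite sumrB sumr_const -mulr_sumr lerB // -[leLHS]mulr_natl ler_wpM2r //.
  by rewrite divr_ge0 ?sqr_ge0.
apply: ler_sum => j _; have := sqr_ge0 (t j - y / 2).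
by rewrite sqrrB; lra.
Qed.

End Forms.

(** * The up-Laplacian and the Gram matrix of the facets *)

Section Laplacian.
Variables (R : realType) (V : finType) (K : {set {set V}}) (o : {set V} -> seq V) (k : nat).
Hypotheses (hK : simplicial_complex K) (hk : (1 <= k)%N) (ho : orientation K o).
Implicit Types (F G H r : {set V}) (S : {set {set V}}).
Let D := max_ridge_degree K k.
Let e := facet_adj K k.
Let sg := adj_sign o.

(** Indexed by all vertex sets: a set that is not a facet is isolated, with diagonal entry
    [D - 1]. *)
Definition shifted_adj F G : int := signed_weight e (D%:Z - 1) sg F G.

Lemma shifted_adj_sym F G : shifted_adj F G = shifted_adj G F.
Proof. by rewrite /shifted_adj /signed_weight eq_sym /e facet_adj_sym // setUC. Qed.

Lemma shifted_adj_diag F : shifted_adj F F = D%:Z - 1.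
Proof. by rewrite /shifted_adj /signed_weight eqxx. Qed.

Lemma shifted_adj_neq F G : F != G -> shifted_adj F G = if e F G then - sg [set F; G] else 0.
Proof. by rewrite /shifted_adj /signed_weight => /negPf->. Qed.

Lemma shifted_adj_nonface F G : F \notin faces K k ->
  shifted_adj F G = if F == G then D%:Z - 1 else 0.
Proof.
move=> FK; rewrite /shifted_adj /signed_weight /e facet_adjE // (negPf FK).
by case: eqP.
Qed.

Lemma incidence_eq0 r F : ~~ (r \subset F) -> incidence o r F = 0.
Proof.
move=> rF; rewrite /incidence; case: pickP => // v /andP[_ /eqP Dr].
by rewrite Dr subD1set in rF.
Qed.

(** A facet has [k + 1] ridges, each contributing 1 to the diagonal, and two distinct facets can
    only share the ridge [F :&: G]. *)
Lemma gram_incidence F G : F \in faces K k -> G \in faces K k ->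
  \sum_(r in faces K k.-1) incidence o r F * incidence o r G =
  (D%:Z + k%:Z) * (F == G)%:R - shifted_adj F G.
Proof.
move=> FK GK; have [<-|nFG] := eqVneq F G.
  rewrite shifted_adj_diag mulr1 (bigID (fun r => r \subset F)) /=.
  rewrite [X in _ + X]big1 ?addr0 => [|r /andP[_ rF]]; last by rewrite incidence_eq0 ?mul0r.
  rewrite (eq_bigl (mem [set F :\ v | v in F])) => [|r]; last first.
    apply/andP/imsetP => [[rR rF]|[v vF ->]].
      by have [|v vF ->] := @fan_facet _ K k hk r F rR; [rewrite inE FK|exists v].
    split; last exact: subD1set.
    rewrite mem_ridges // (hK (faces_mem FK)) ?subD1set //=.
    by have := cardsD1 v F; rewrite vF (faces_card FK) add1n => -[<-].
  rewrite big_imset => [|v w vF wF /setP/(_ v)]; last first.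
    by rewrite !inE eqxx vF andbT /=; case: eqP.
  rewrite (eq_bigr (fun=> 1)) => [|v vF]; last by rewrite (incidence_sqr hK ho (faces_mem FK)).
  by rewrite sumr_const (faces_card FK) natz; ring.
rewrite shifted_adj_neq // mulr0 sub0r.
have rFG r : r \in faces K k.-1 -> r != F :&: G -> incidence o r F * incidence o r G = 0.
  move=> rR nr; have [rF|] := boolP (r \subset F); last by move/incidence_eq0->; rewrite mul0r.
  have [rG|] := boolP (r \subset G); last by move/incidence_eq0->; rewrite mulr0.
  have rF' : F \in fan K k r by rewrite inE FK.
  have rG' : G \in fan K k r by rewrite inE GK.
  by case/eqP: nr; rewrite (fan_setI hk rR rF' rG' nFG).
case: ifPn => [FG|nFG'].
  have [rR _ _] := adj_fan FG.
  rewrite (bigD1 (F :&: G)) //= big1 ?addr0 ?opprK => [|r /andP[rR' nr]]; last exact: rFG.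
  by rewrite /sg adj_signE.
rewrite oppr0 big1 // => r rR; apply: rFG => //; apply: contraNneq nFG' => Dr.
by rewrite /e /facet_adj /= FK GK nFG -Dr.
Qed.

Definition shifted_adjR F G : R := (shifted_adj F G)%:~R.

Lemma shifted_adjR_sym F G : shifted_adjR F G = shifted_adjR G F.
Proof. by rewrite /shifted_adjR shifted_adj_sym. Qed.

Lemma gram_matrix (x : {set V} -> R) G : G \in faces K k ->
  \sum_(F in faces K k) x F *
    (\sum_(r in faces K k.-1) (incidence o r F)%:~R * (incidence o r G)%:~R) =
  (D%:R + k%:R) * x G - \sum_(F in faces K k) x F * shifted_adjR F G.
Proof.
move=> GK.
have -> : (D%:R + k%:R) * x G = \sum_(F in faces K k) (D%:R + k%:R) * (x F * (F == G)%:R).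
  rewrite -mulr_sumr (bigD1 G) //= eqxx mulr1 big1 ?addr0 // => F /andP[_ /negPf->].
  by rewrite mulr0.
rewrite -sumrB; apply: eq_bigr => F FK.
under eq_bigr do rewrite -intrM.
rewrite -rmorph_sum gram_incidence //= rmorphB rmorphM rmorphD /= rmorph_nat.
by rewrite mulrBr mulrCA.
Qed.

Lemma gram_boundary (x : {set V} -> R) j (G := enum_val j) :
  (forall F, F \notin faces K k -> x F = 0) ->
  ((\row_i x (enum_val i)) *m (boundary R K o k)^T *m boundary R K o k) 0 j =
  (D%:R + k%:R) * x G - \sum_F x F * shifted_adjR F G.
Proof.
move=> x0; have GK : G \in faces K k by apply: enum_valP.
have -> : \sum_F x F * shifted_adjR F G = \sum_(F in faces K k) x F * shifted_adjR F G.
  rewrite [RHS]big_mkcond; apply: eq_bigr => F _.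
  by case: ifPn => // /x0->; rewrite mul0r.
rewrite -gram_matrix // -mulmxA mxE [RHS]big_enum_val; apply: eq_bigr => i _.
rewrite !mxE; congr (_ * _); rewrite [RHS]big_enum_val; apply: eq_bigr => r _.
by rewrite !mxE.
Qed.

(** A matrix times its transpose has the same nonzero eigenvalues in either order: eigenvectors are
    carried over by the boundary matrix and its transpose, and vectors on facets are extended by
    zero. *)
Lemma eigenvalue_up_laplacianP (lam : R) : lam != 0 ->
  reflect (exists2 x : {set V} -> R, exists F, x F != 0 &
     (forall F, F \notin faces K k -> x F = 0) /\
     (forall G, \sum_F x F * shifted_adjR F G = (D%:R + k%:R - lam) * x G))
   (eigenvalue (up_laplacian R K o k) lam).
Proof.
move=> nlam; set B := boundary R K o k.
apply: (iffP (@eigenvalueP _ _ _ _)) => [[v vL nv]|[x [F nxF] [x0 xM]]].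
  pose w := v *m B; pose x F := \sum_j w 0 j * (enum_val j == F)%:R.
  have xw j : x (enum_val j) = w 0 j.
    by rewrite -[RHS](sum_delta j (fun j => w 0 j)); apply: eq_bigr => i _; rewrite (inj_eq enum_val_inj).
  have x0 F : F \notin faces K k -> x F = 0.
    move=> FK; apply: big1 => j _; case: eqP => [Dj|_]; last by rewrite mulr0.
    by rewrite -Dj enum_valP in FK.
  have wx : w = \row_j x (enum_val j) by apply/rowP => j; rewrite [RHS]mxE xw.
  have wG : w *m B^T *m B = lam *: w by rewrite /w -[v *m B *m B^T]mulmxA vL scalemxAl.
  have nw : w != 0.
    apply: contraNneq nv => w0; move: vL; rewrite /up_laplacian mulmxA -/B -/w w0 mul0mx.
    by move/esym/eqP; rewrite scaler_eq0 (negPf nlam).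
  exists x; first by have /rV0Pn[j] := nw; rewrite -xw => nxj; exists (enum_val j).
  split=> // G; have [GK|GK] := boolP (G \in faces K k); last first.
    rewrite x0 // mulr0 big1 // => F _; rewrite shifted_adjR_sym /shifted_adjR shifted_adj_nonface //.
    by case: eqP => [<-|_]; rewrite ?mulr0 // x0 ?mul0r.
  have := gram_boundary (enum_rank_in GK G) x0; rewrite -wx wG mxE -xw enum_rankK_in // => E.
  by rewrite mulrBl E; ring.
have FK : F \in faces K k by apply: contraNT nxF => /x0->.
pose w : 'rV_#|faces K k| := \row_j x (enum_val j).
have wG : w *m B^T *m B = lam *: w.
  apply/rowP => j; rewrite gram_boundary // xM !mxE.
  by ring.
exists (w *m B^T); first by rewrite /up_laplacian mulmxA -/B wG scalemxAl.
apply: contraNneq nxF => w0; move: wG; rewrite w0 mul0mx => /esym/eqP.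
rewrite scaler_eq0 (negPf nlam) /= => /eqP/rowP/(_ (enum_rank_in FK F)).
by rewrite !mxE enum_rankK_in // => ->.
Qed.

End Laplacian.

(** * Fan vectors and nonnegativity of the principal minors *)

Section FacetMinors.
Variables (R : realType) (V : finType) (K : {set {set V}}) (o : {set V} -> seq V) (k : nat).
Hypotheses (hK : simplicial_complex K) (hk : (1 <= k)%N) (ho : orientation K o).
Implicit Types (F G H r : {set V}) (S : {set {set V}}).
Let D := max_ridge_degree K k.
Let e := facet_adj K k.
Let sg := adj_sign o.
Let Mi := shifted_adj K o k.
Let M := shifted_adjR R K o k.

Lemma pminor_elementary S : pminor M S = (elementary_sum K o k D S)%:~R.
Proof.
have sg_sq F G : e F G -> sg [set F; G] * sg [set F; G] = 1 by apply: adj_sign_sqr.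
rewrite /elementary_sum.
rewrite -(sum_perm_elementary (facet_adj_sym hK hk) (facet_adj_irr hK hk) _ sg_sq).
rewrite pminorE rmorph_sum; apply: eq_bigr => p _.
by rewrite rmorphM rmorph_prod rmorph_sign.
Qed.

Lemma degree_le r : r \in faces K k.-1 -> (degree K k r <= D)%N.
Proof. exact: (@leq_bigmax_cond _ (mem (faces K k.-1))). Qed.

Lemma max_degree_ridge : (0 < D)%N -> exists2 r, r \in faces K k.-1 & degree K k r = D.
Proof.
rewrite /D /max_ridge_degree; have [r0 rR|R0] := pickP (mem (faces K k.-1)); last by rewrite big_pred0.
have [|r rR' ->] := @eq_bigmax_cond _ (mem (faces K k.-1)) (degree K k); last by exists r.
by apply/card_gt0P; exists r0.
Qed.

(** For a ridge [r], this is row [r] of the boundary matrix, extended by zero to all vertex sets. *)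
Definition fan_vector r F : int := if F \in fan K k r then incidence o r F else 0.

(** The diagonal entry [D - 1] is cancelled by the other [D - 1] members of the fan, each of which
    contributes minus the incidence of [G]. *)
Lemma fan_vector_in r G : r \in faces K k.-1 -> degree K k r = D -> G \in fan K k r ->
  \sum_F fan_vector r F * Mi F G = 0.
Proof.
move=> rR rD rG.
have -> : \sum_F fan_vector r F * Mi F G = \sum_(F in fan K k r) incidence o r F * Mi F G.
  rewrite [RHS]big_mkcond; apply: eq_bigr => F _; rewrite /fan_vector.
  by case: ifP; rewrite ?mul0r.
rewrite (bigD1 G) //= /Mi shifted_adj_diag.
rewrite (eq_bigr (fun=> - incidence o r G)) => [|F /andP[rF nFG]]; last first.
  rewrite shifted_adj_neq // (fan_adj hk rR rF rG nFG) (fan_adj_sign o hk rR rF rG nFG).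
  by rewrite mulrN mulrA (incidence_fan_sqr hK hk ho rR rF) mul1r.
have : \sum_(F in fan K k r) - incidence o r G = - incidence o r G *+ D.
  by rewrite sumr_const -[#|fan K k r|]/(degree K k r) rD.
rewrite (bigD1 G) //= => /(canRL (addKr _))->; rewrite opprK -mulr_natl natz -/D.
by ring.
Qed.

Lemma fan_vector_out r G : G \notin fan K k r ->
  \sum_F fan_vector r F * Mi F G =
  - \sum_(F in [set F in fan K k r | e G F]) incidence o r F * sg [set F; G].
Proof.
move=> rG; have nFG F : F \in fan K k r -> F != G by move=> rF; apply: contraNneq rG => <-.
rewrite [in RHS]big_mkcond -sumrN; apply: eq_bigr => F _; rewrite inE /fan_vector.
case: ifP => [rF|_] /=; last by rewrite mul0r oppr0.
rewrite /Mi shifted_adj_neq ?nFG // /e facet_adj_sym //.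
by case: ifP; rewrite ?mulr0 ?mulrN // oppr0.
Qed.

(** Outside the fan, two neighbours [F1] and [F2] of [G] cannot share a ridge with it, since [G]
    does not contain [r]. All three therefore lie in a common simplex, and the sign rule of
    [adj_same_vertex] makes the two contributions cancel. *)
Lemma fan_vector_clean r G : r \in faces K k.-1 -> degree K k r = D -> clean K k r ->
  \sum_F fan_vector r F * Mi F G = 0.
Proof.
move=> rR rD r_clean; have [rG|rG] := boolP (G \in fan K k r); first exact: fan_vector_in.
have nFG F : F \in fan K k r -> F != G by move=> rF; apply: contraNneq rG => <-.
rewrite fan_vector_out //.
have [GK|GK] := boolP (G \in faces K k); last first.
  rewrite big1 ?oppr0 // => F; rewrite inE /e facet_adjE // (negPf GK) /=.
  by rewrite andbF.
have [/cards0_eq->|/eqP/cards2P[F1 [F2 [n12 DN]]]] := r_clean G GK rG.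
  by rewrite big_set0 oppr0.
have [rF1 GF1] : F1 \in fan K k r /\ e G F1.
  by have := set21 F1 F2; rewrite -DN inE => /andP[].
have [rF2 GF2] : F2 \in fan K k r /\ e G F2.
  by have := set22 F1 F2; rewrite -DN inE => /andP[].
have e12 := fan_adj hk rR rF1 rF2 n12.
have e1G : e F1 G by rewrite /e facet_adj_sym.
have e2G : e F2 G by rewrite /e facet_adj_sym.
rewrite DN big_setU1 ?inE //= big_set1.
have [Er|Ev] := adj_cases hK hk e12 e1G e2G.
  case/negP: rG; rewrite inE GK -(fan_setI hk rR rF1 rF2 n12) Er.
  exact: subsetIr.
have [_] := adj_same_vertex hK hk ho e12 e1G (nFG F2 rF2) Ev.
rewrite /sg => ->; rewrite (fan_adj_sign o hk rR rF1 rF2 n12).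
have := incidence_fan_sqr hK hk ho rR rF2; move: (incidence o r F2) => b bb.
rewrite (_ : - _ = incidence o r F1 * adj_sign o [set F1; G] * (b * b - 1)); last by ring.
by rewrite bb subrr mulr0.
Qed.

(** Given one neighbour [F1], any other must contain the vertex of [G] missing from [F1], and so
    equals [r] together with that vertex. *)
Lemma fan_neighbours r G : r \in faces K k.-1 -> G \notin fan K k r ->
  (#|[set F in fan K k r | e G F]| <= 2)%N.
Proof.
move=> rR rG; set N := [set F in _ | _].
have [->|/set0Pn[F1 NF1]] := eqVneq N set0; first by rewrite cards0.
have [rF1 GF1] : F1 \in fan K k r /\ e G F1 by move: NF1; rewrite inE => /andP[].
suff /subset_leq_card/leq_trans-> : N \subset [set F1; r :|: (G :\: F1)] => //.
  by rewrite cards2; case: (_ == _).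
apply/subsetP => F; rewrite inE => /andP[rF' GF]; rewrite !inE.
have [->//|nF] := eqVneq F F1; rewrite /=.
have n1F : F1 != F by rewrite eq_sym.
have e1F := fan_adj hk rR rF1 rF' n1F.
have e1G : e F1 G by rewrite /e facet_adj_sym.
have eFG : e F G by rewrite /e facet_adj_sym.
have [Er|Ev] := adj_cases hK hk e1F e1G eFG.
  case/negP: rG; rewrite inE -(fan_setI hk rR rF1 rF' n1F) Er subsetIr andbT.
  by have [] := facet_adj_faces hK hk eFG.
by rewrite -Ev -(fan_setI hk rR rF1 rF' n1F) setIC setID.
Qed.

Definition signed_adj F G : R := (if e F G then sg [set F; G] else 0)%:~R.

Lemma signed_adj_sym F G : signed_adj F G = signed_adj G F.
Proof. by rewrite /signed_adj setUC /e facet_adj_sym. Qed.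

Lemma shifted_adjR_signed_adj F G : M F G = (D%:R - 1) * (F == G)%:R - signed_adj F G.
Proof.
rewrite /M /shifted_adjR /signed_adj; have [<-|nFG] := eqVneq F G.
  by rewrite shifted_adj_diag /e facet_adj_irr // subr0 mulr1 rmorphB.
rewrite shifted_adj_neq // mulr0 sub0r -/e; case: ifP => _.
  by rewrite rmorphN.
by rewrite oppr0.
Qed.

Lemma shifted_adjR_form S x : \sum_(F in S) \sum_(G in S) x F * M F G * x G =
  (D%:R - 1) * (\sum_(F in S) x F ^+ 2)
    - \sum_(F in S) \sum_(G in S) x F * signed_adj F G * x G.
Proof.
rewrite mulr_sumr -sumrB; apply: eq_bigr => F FS.
have -> : (D%:R - 1) * x F ^+ 2 = \sum_(G in S) x F * ((D%:R - 1) * (F == G)%:R) * x G.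
  rewrite (bigD1 F) //= eqxx mulr1 big1 ?addr0 => [|G /andP[_ /negPf nG]]; first by ring.
  by rewrite eq_sym nG !mulr0 mul0r.
rewrite -sumrB; apply: eq_bigr => G _; rewrite shifted_adjR_signed_adj.
by ring.
Qed.

Lemma normr_signed_adj F G : `|signed_adj F G| = (e F G)%:R.
Proof.
rewrite /signed_adj; case: ifP => [FG|_]; last by rewrite normr0.
have := adj_sign_sqr hK hk ho FG; rewrite -/sg => /(congr1 (fun z : int => z%:~R : R)).
rewrite rmorphM /= -expr2 => /eqP; rewrite sqrf_eq1 => /orP[]/eqP->; rewrite ?normrN normr1 //.
Qed.

Lemma psd_low_degree S : (0 < D)%N -> (induced_max_degree e S < D)%N -> psd S M.
Proof.
move=> D0 degS x; rewrite shifted_adjR_form subr_ge0; apply: row_sum_form_le; first exact: signed_adj_sym.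
move=> F FS; under eq_bigr do rewrite normr_signed_adj.
rewrite -natr_sum -(natrB _ D0) ler_nat leq_subRL // add1n.
apply: leq_ltn_trans degS.
rewrite -big_mkcondr sum1dep_card.
exact: (@leq_bigmax_cond _ (mem S) (fun F => #|[set G in S | e F G]|) F FS).
Qed.

(* Write s G for the sign of the pair {F0, G}. On S \ F0 the signed adjacency is
   s G * s H * ([F0 & G = F0 & H] - [G \ F0 = H \ F0]); the first term costs at most
   D - 2, and the second one is a sum of squares of the class sums. *)
Lemma psd_star S F0 : (1 < D)%N -> F0 \in S -> #|S| = D.+1 ->
  (forall G, G \in S -> G != F0 -> e F0 G) ->
  (forall r, r \in faces K k.-1 -> (#|[set G in S | r \subset G]| < D)%N) ->
  psd S M.
Proof.
move=> D1 F0S cS star ridgeS x; rewrite shifted_adjR_form subr_ge0.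
pose S' := S :\ F0.
have cS' : #|S'| = D by have := cardsD1 F0 S; rewrite F0S cS add1n => -[].
have eS G : G \in S' -> e F0 G by rewrite !inE => /andP[nG GS]; apply: star.
pose s G : R := (sg [set F0; G])%:~R.
have s2 G : G \in S' -> s G * s G = 1.
  by move=> /eS FG; rewrite /s -intrM (adj_sign_sqr hK hk ho FG).
pose z G := s G * x G.
pose rho G H : R := (F0 :&: G == F0 :&: H)%:R.
pose nu G H : R := (G :\: F0 == H :\: F0)%:R.
have sumS (g : {set V} -> R) : \sum_(G in S) g G = g F0 + \sum_(G in S') g G.
  rewrite (bigD1 F0) //=; congr (_ + _); apply: eq_bigl => G.
  by rewrite !inE andbC.
have z2 G : G \in S' -> z G ^+ 2 = x G ^+ 2.
  by move=> GS; rewrite exprMn [s G ^+ 2]expr2 s2 ?mul1r.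
have adjS G H : G \in S' -> H \in S' ->
    x G * signed_adj G H * x H = z G * rho G H * z H - z G * nu G H * z H.
  move=> GS HS; have [eG eH] := (eS G GS, eS H HS).
  have [<-|nGH] := eqVneq G H.
    by rewrite /rho /nu !eqxx subrr /signed_adj /e facet_adj_irr // mulr0 mul0r.
  have -> : signed_adj G H = s G * s H * (rho G H - nu G H).
    rewrite /rho /nu; have [Er|nr] := eqVneq (F0 :&: G) (F0 :&: H).
      have [eGH Es] := adj_same_ridge hK hk ho eG eH nGH Er.
      have [Ev|nv] := eqVneq (G :\: F0) (H :\: F0).
        by case/eqP: nGH; apply: adj_ridge_vertex Er Ev.
      by rewrite /signed_adj /e eGH /sg Es rmorphM subr0 mulr1.
    have [Ev|nv] := eqVneq (G :\: F0) (H :\: F0).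
      have [eGH Es] := adj_same_vertex hK hk ho eG eH nGH Ev.
      by rewrite /signed_adj /e eGH /sg Es rmorphN rmorphM sub0r mulrN1.
    rewrite /signed_adj subrr mulr0; case: ifP => // eGH.
    by case: (adj_cases hK hk eG eH eGH) => /eqP; rewrite ?(negPf nr) ?(negPf nv).
  by rewrite /z; ring.
pose Z := \sum_(G in S') z G.
have cross : \sum_(G in S') x F0 * signed_adj F0 G * x G = x F0 * Z.
  rewrite mulr_sumr; apply: eq_bigr => G GS; rewrite /signed_adj eS // /z /s.
  by ring.
pose P := \sum_(G in S') \sum_(H in S') z G * rho G H * z H.
pose W := \sum_(G in S') \sum_(H in S') z G * nu G H * z H.
pose Q := \sum_(G in S') z G ^+ 2.
have -> : \sum_(F in S) \sum_(G in S) x F * signed_adj F G * x G = x F0 * Z *+ 2 + P - W.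
  have A00 : signed_adj F0 F0 = 0 by rewrite /signed_adj /e facet_adj_irr.
  rewrite sumS sumS A00 mulr0 mul0r add0r cross.
  rewrite (eq_bigr (fun G => x F0 * z G + \sum_(H in S') (z G * rho G H * z H - z G * nu G H * z H))).
    rewrite big_split /= -mulr_sumr -/Z mulr2n -!addrA; congr (_ + (_ + _)).
    by rewrite -sumrB; apply: eq_bigr => G _; rewrite sumrB.
  move=> G GS; rewrite sumS; congr (_ + _); last by apply: eq_bigr => H HS; apply: adjS.
  by rewrite signed_adj_sym /signed_adj eS // /z /s; ring.
have -> : \sum_(F in S) x F ^+ 2 = x F0 ^+ 2 + Q.
  by rewrite sumS; congr (_ + _); apply: eq_bigr => G GS; rewrite z2.
(* The facets of [S] over the ridge [F0 :&: G] number at most [D - 1], and [F0] is one of them; this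
   leaves at most [D - 2] in each row. *)
have leP : P <= (D%:R - 2) * Q.
  apply: row_sum_form_le => [G H|G GS]; first by rewrite /rho eq_sym.
  rewrite (eq_bigr (fun H => (F0 :&: G == F0 :&: H)%:R)) => [|H _]; last first.
    by rewrite /rho ger0_norm // ler0n.
  rewrite -natr_sum -(natrB _ D1) ler_nat leq_subRL // add2n.
  have [rR rF0 _] := adj_fan (eS G GS).
  apply: leq_ltn_trans (ridgeS _ rR).
  rewrite (cardsD1 F0) inE F0S subsetIl /= add1n ltnS.
  rewrite -big_mkcondr sum1dep_card; apply: subset_leq_card; apply/subsetP => H.
  rewrite !inE => /andP[/andP[nH HS] /eqP->]; rewrite nH HS subsetIr.
  by [].
have geW : x F0 * Z - D%:R * (x F0 ^+ 2 / 4) <= W.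
  by rewrite -cS'; apply: fiber_form_ge.
have geQ : x F0 * Z - D%:R * (x F0 ^+ 2 / 4) <= Q.
  have : 0 <= \sum_(G in S') (z G - x F0 / 2) ^+ 2 by apply: sumr_ge0 => G _; apply: sqr_ge0.
  rewrite (eq_bigr (fun G => z G ^+ 2 - x F0 * z G + x F0 ^+ 2 / 4)) => [|G _]; last by field.
  rewrite big_split /= sumrB -mulr_sumr sumr_const cS' -/Q -/Z -mulr_natl.
  by lra.
(* Adding the bounds on [P], [W] and [Q] leaves exactly half of this quantity as slack. *)
have D2 : 0 <= (D%:R - 2) * x F0 ^+ 2 :> R.
  by rewrite mulr_ge0 ?sqr_ge0 // subr_ge0 ler_nat.
lra.
Qed.

Definition fan_real r F : R := (fan_vector r F)%:~R.

Lemma fan_realM r G : \sum_F fan_real r F * M F G = (\sum_F fan_vector r F * Mi F G)%:~R.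
Proof. by rewrite rmorph_sum; apply: eq_bigr => F _; rewrite rmorphM. Qed.

Lemma fan_real_neq0 r F : r \in faces K k.-1 -> F \in fan K k r -> fan_real r F != 0.
Proof.
move=> rR rF; rewrite /fan_real /fan_vector rF intr_eq0.
apply: contraNneq (oner_neq0 int) => r0.
by rewrite -(incidence_fan_sqr hK hk ho rR rF) r0 mul0r.
Qed.

Lemma fan_nonempty r : (0 < D)%N -> degree K k r = D -> exists F, F \in fan K k r.
Proof. by move=> D0 rD; apply/card_gt0P; rewrite -/(degree K k r) rD. Qed.

Lemma pminor_ge0 S : (1 < D)%N ->
  (forall r, r \in faces K k.-1 -> degree K k r = D -> clean K k r) ->
  (forall FF : {set {set V}}, FF \subset faces K k -> induced_connected e FF ->
     (D + 2 <= #|FF|)%N -> (D <= induced_max_degree e FF)%N ->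
     0 <= elementary_sum K o k D FF) ->
  0 <= pminor M S.
Proof.
move=> D1 ridge_clean large_ge0; have D0 : (0 < D)%N by apply: ltnW.
(* The induction serves only the disconnected case, where both pieces are smaller. *)
have [n] := ubnP #|S|; elim: n S => // n IH S ltS.
have [lowS|highS] := ltnP (induced_max_degree e S) D.
  by apply: pminor_psd_ge0; apply: psd_low_degree.
have [F0 F0S degF0] : exists2 F0, F0 \in S & (D <= #|[set G in S | e F0 G]|)%N.
  move: highS; rewrite /induced_max_degree; have [S0|/card_gt0P S0] := posnP #|S|.
    by rewrite (cards0_eq S0) big_set0 leqNgt D0.
  have [|F FS ->] := @eq_bigmax_cond _ (mem S) (fun x => #|[set y in S | e x y]|).
    exact/card_gt0P.
  by exists F.
have [/forall_inP conS|] := boolP [forall F in S, [forall G in S, connect (induced e S) F G]]; last first.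
{ case/forall_inPn=> F FS /forall_inPn[G GS nFG].
  pose S1 := [set H in S | connect (induced e S) F H].
  have FS1 : F \in S1 by rewrite inE FS connect0.
  have sS1 : S1 \subset S by apply/subsetP => H; rewrite inE => /andP[].
  have -> : S = S1 :|: S :\: S1.
    by rewrite setDE setUIr setUCr setIT; apply/esym/setUidPr.
  rewrite pminor_disjoint.
  - rewrite ltnS in ltS; apply: mulr_ge0; apply: IH; apply: leq_trans ltS; apply: proper_card.
      by apply/properP; split=> //; exists G; rewrite // inE GS.
    apply/properP; split; first exact: subsetDl.
    by exists F; rewrite // inE FS1.
  - by rewrite -setI_eq0 setDE setICA setICr setI0.
  - move=> A B; rewrite inE => /andP[AS FA]; rewrite !inE => /andP[nB BS].
    rewrite BS /= in nB; suff nAB : ~~ e A B.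
      have nBA : ~~ e B A by rewrite /e facet_adj_sym.
      have neAB : A != B by apply: contraNneq nB => <-.
      by rewrite /M /shifted_adjR shifted_adj_sym // shifted_adj_neq 1?eq_sym // -/e (negPf nBA).
    apply: contra nB => eAB; apply: connect_trans FA _; apply: connect1.
    by rewrite /induced /= AS BS. }
have F0K : F0 \in faces K k.
  have /card_gt0P[G] : (0 < #|[set G in S | e F0 G]|)%N by apply: leq_trans degF0.
  by rewrite inE => /andP[_ /(facet_adj_faces hK hk)[]].
have SK : S \subset faces K k.
  apply/subsetP => F FS; have /forall_inP/(_ _ F0S)/connectP[p] := conS F FS.
  case: p => [_ /= <- //|G p /= /andP[/and3P[_ _ eFG] _] _].
  by have [] := facet_adj_faces hK hk eFG.
have [large|small] := leqP (D + 2) #|S|.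
  rewrite pminor_elementary ler0z; apply: large_ge0 => //.
  by move=> F G FS GS; have /forall_inP := conS F FS; apply.
(* Now [S] has at most [D + 1] members while [F0] has at least [D] neighbours in it, so [F0] is
   adjacent to all the others. *)
have sN : [set G in S | e F0 G] \subset S :\ F0.
  apply/subsetP => G; rewrite !inE => /andP[-> eG]; rewrite andbT.
  by apply: contraTneq eG => ->; rewrite /e facet_adj_irr.
have cS : #|S| = D.+1.
  have := subset_leq_card sN; have := cardsD1 F0 S; rewrite F0S.
  by lia.
have star G : G \in S -> G != F0 -> e F0 G.
  move=> GS nG; have : [set G in S | e F0 G] == S :\ F0.
    rewrite eqEcard sN; apply: leq_trans degF0.
    by have := cardsD1 F0 S; rewrite F0S; lia.
  by move=> /eqP/setP/(_ G); rewrite !inE GS nG.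
have [/exists_inP[r rR]|/exists_inPn ridgeS] := boolP [exists r in faces K k.-1, (D <= #|[set G in S | r \subset G]|)%N]; last first.
  apply: pminor_psd_ge0; apply: (psd_star D1 F0S cS star) => r /ridgeS.
  by rewrite -ltnNge.
move=> rS; have sr : [set G in S | r \subset G] \subset fan K k r.
  by apply/subsetP => G; rewrite inE => /andP[/(subsetP SK) GK rG]; rewrite inE GK.
(* At least [D] members of [S] contain [r], whose degree is at most [D]; hence [S] contains the
   whole fan and its vector is supported in [S]. *)
have Efan : [set G in S | r \subset G] = fan K k r.
  by apply/eqP; rewrite eqEcard sr (leq_trans (degree_le rR)).
have rD : degree K k r = D.
  by apply/eqP; rewrite eqn_leq degree_le //= /degree -Efan.
have [F rF] := fan_nonempty D0 rD.
rewrite (@pminor_eq0 _ _ _ _ (fan_real r) F) ?fan_real_neq0 //.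
  move=> G GS; rewrite /fan_real /fan_vector; case: ifP => // ; rewrite -Efan inE (negPf GS).
  by [].
by move=> G _; rewrite fan_realM fan_vector_clean //; apply: ridge_clean.
Qed.

End FacetMinors.

(** * The largest eigenvalue *)

Theorem theorem4p17 (R : realType) (V : finType) (K : {set {set V}})
    (o : {set V} -> seq V) (k : nat)
    (hK : simplicial_complex K) (hk : (1 <= k)%N) (hdim : has_dimension K k)
    (hKk : faces K k != set0) (ho : orientation K o) :
  let D := max_ridge_degree K k in
  let L := up_laplacian R K o k in
  (D = 1%N ->
     largest_eigenvalue L (k%:R + 1) /\ k%:R + 1 = D%:R + k%:R :> R) /\
  ((2 <= D)%N ->
     (largest_eigenvalue L (D%:R + k%:R) <->
      (forall r : {set V}, r \in faces K k.-1 -> degree K k r = D ->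
         clean K k r) /\
      (forall FF : {set {set V}}, FF \subset faces K k ->
         induced_connected (facet_adj K k) FF ->
         (D + 2 <= #|FF|)%N ->
         (D <= induced_max_degree (facet_adj K k) FF)%N ->
         0 <= elementary_sum K o k D FF))).
Proof.

Proof.
move=> D L.
have eigenP lam : lam != 0 -> _ := @eigenvalue_up_laplacianP R V K o k hK hk ho lam.
split=> [D1|D2].
  (* With [D = 1] no ridge lies in two facets, so the shifted matrix is zero and the only nonzero
     eigenvalue is [k + 1]. *)
  have e0 F G : facet_adj K k F G = false.
    apply/negP => FG; have [rR rF rG] := adj_fan FG.
    have [_ _ nFG _] := facet_adj_faces hK hk FG.
    have := degree_le rR; rewrite -/D D1 leqNgt => /negP; apply.
    by apply/card_gt1P; exists F, G.
  have M0 F G : shifted_adjR R K o k F G = 0.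
    rewrite /shifted_adjR /shifted_adj /signed_weight -/D D1 subrr e0.
    by case: ifP.
  split; last by rewrite D1 addrC.
  have k1 : k%:R + 1 != 0 :> R by rewrite natr1 pnatr_eq0.
  split.
    have /set0Pn[F FK] := hKk; apply/(eigenP _ k1).
    exists (fun G => (G == F)%:R); first by exists F; rewrite eqxx oner_eq0.
    split=> [G GK|G]; first by case: eqP => // GF; rewrite GF FK in GK.
    by rewrite big1 => [|H _]; rewrite ?M0 ?mulr0 // -/D D1 [k%:R + 1]addrC subrr mul0r.
  move=> b; have [->|nb] := eqVneq b 0; first by rewrite addr_ge0 ?ler0n ?ler01.
  move=> /(eigenP _ nb)[x [F nxF] [_ /(_ F)]].
  rewrite big1 => [/esym/eqP|H _]; last by rewrite M0 mulr0.
  by rewrite -/D D1 mulf_eq0 (negPf nxF) orbF subr_eq0 [k%:R + 1]addrC => /eqP->.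
have D0 : (0 < D)%N by apply: ltnW.
have Dk0 : 0 < D%:R + k%:R :> R by rewrite ltr_wpDr ?ler0n ?ltr0n.
have D1R : 1 < D%:R :> R by rewrite ltr1n.
split=> [[_ Lmax]|[ridge_clean large_ge0]].
  have Mpsd : psd setT (shifted_adjR R K o k).
    move=> x.
    have -> : \sum_(a in [set: {set V}]) \sum_(b in [set: {set V}]) x a * shifted_adjR R K o k a b * x b =
        \sum_a \sum_b x a * shifted_adjR R K o k a b * x b.
      apply: eq_big => [a|a _]; first by rewrite inE.
      by apply: eq_bigl => b; rewrite inE.
    apply: sym_form_ge0 => [|t y t0 yM a]; first exact: shifted_adjR_sym.
    apply/eqP; apply: contraT => nya.
    have nlam : D%:R + k%:R - t != 0 by rewrite gt_eqF //; lra.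
    suff /Lmax : eigenvalue L (D%:R + k%:R - t) by lra.
    apply/(eigenP _ nlam); exists y; first by exists a.
    split=> [F FK|F]; last by rewrite yM; congr (_ * _); ring.
    (* At a set that is not a facet the equation reads [(D - 1) * y F = t * y F], and [t] is
       negative, so [y F] vanishes. *)
    have := yM F; rewrite (bigD1 F) //= big1 ?addr0 => [|G nG]; last first.
      by rewrite shifted_adjR_sym // /shifted_adjR shifted_adj_nonface // eq_sym (negPf nG) mulr0.
    rewrite /shifted_adjR shifted_adj_nonface // eqxx -/D => /eqP.
    rewrite mulrC -subr_eq0 -mulrBl mulf_eq0 => /orP[|/eqP//].
    rewrite rmorphB /= gt_eqF //.
    by lra.
  split=> [r rR rD G GK rG|FF _ _ _ _]; last first.
    rewrite -(ler0z R) -(pminor_elementary R hK hk ho).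
    apply: pminor_psd_ge0 => x.
    (* Extension by zero turns the form on [FF] into a value of the full form. *)
    pose y F := if F \in FF then x F else 0.
    have := Mpsd y; congr (0 <= _).
    rewrite [RHS]big_mkcond; apply: eq_big => [F|F _]; first by rewrite inE.
    rewrite /y; case: ifP => FFF; last by apply: big1 => G _; rewrite !mul0r.
    rewrite [RHS]big_mkcond; apply: eq_big => [G|G _]; first by rewrite inE.
    by case: ifP; rewrite ?mulr0.
  have fan0 : \sum_F fan_real R K o k r F * shifted_adjR R K o k F G = 0.
    apply: (psd_kernel _ Mpsd); first exact: shifted_adjR_sym.
    apply: big1 => H _; rewrite fan_realM //.
    have [rH|rH] := boolP (H \in fan K k r); first by rewrite fan_vector_in ?mul0r.
    by rewrite /fan_real /fan_vector (negPf rH) mulr0.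
  move: fan0; rewrite fan_realM // => /eqP; rewrite intr_eq0 fan_vector_out // oppr_eq0.
  (* Exactly one neighbour would leave a single product of two signs, which cannot vanish. *)
  have := fan_neighbours hK hk rR rG; case EN: #|_| => [|[|[|n]]] //; [by left| |by right].
  move=> _; have /cards1P[F DN] : #|[set F in fan K k r | facet_adj K k G F]| == 1%N.
    by rewrite EN.
  have [rF GF] : F \in fan K k r /\ facet_adj K k G F.
    by have := set11 F; rewrite -DN inE => /andP[].
  rewrite DN big_set1 mulf_eq0 => /orP[]/eqP E0.
    by have := incidence_fan_sqr hK hk ho rR rF; rewrite E0.
  by have := adj_sign_sqr hK hk ho GF; rewrite setUC E0.
split.
  (* The value [D + k] is attained by the fan vector of any ridge of maximum degree, which cleanness
     puts in the kernel. *)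
  have [r rR rD] := max_degree_ridge D0; have [F rF] := fan_nonempty D0 rD.
  apply/(eigenP _ (lt0r_neq0 Dk0)); exists (fan_real R K o k r).
    by exists F; apply: fan_real_neq0.
  split=> [G GK|G].
    by rewrite /fan_real /fan_vector inE (negPf GK).
  by rewrite fan_realM // fan_vector_clean ?subrr ?mul0r //; apply: ridge_clean.
move=> b Lb; rewrite leNgt; apply/negP => ltb.
have nb : b != 0 by rewrite gt_eqF // (lt_trans Dk0).
have [x [F nxF] [_ xM]] := elimT (eigenP _ nb) Lb.
case/eqP: nxF; apply: (@pminors_no_neg_eigen _ _ (shifted_adjR R K o k) (b - (D%:R + k%:R)) x).
- by move=> A; apply: pminor_ge0.
- by rewrite subr_gt0.
- by move=> G; rewrite xM opprB.
Qed.
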